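(* Let $\mu$ be a finite positive Borel measure on $[0,1)$. Suppose that $0<\alpha<1$ and that $\mu$ is an $\alpha$-logarithmic $1$-Carleson measure. Then $\mathcal H_\mu$ maps $H^1$ into the space $$\mathcal D^1(\log^{\alpha-1})=\left\{f \text{ analytic in }\mathbb D:\ \int_{\mathbb D}|f'(z)|\left(\log\frac{2}{1-|z|}\right)^{\alpha-1}dA(z)<\infty\right\}.$$
   Context: $\mathbb D$ is the open unit disc in $\mathbb C$, $H^1$ is the classical Hardy space on $\mathbb D$, and $dA=\frac1\pi\,dx\,dy$ is normalized area measure on $\mathbb D$. For a finite positive Borel measure $\mu$ on $[0,1)$ and $n\ge 0$, let $\mu_n=\int_{[0,1)}t^n\,d\mu(t)$. For $f(z)=\sum_{k\ge0}a_kz^k$ analytic in $\mathbb D$, define formally $$\mathcal H_\mu f(z)=\sum_{n=0}^\infty\Big(\sum_{k=0}^\infty \mu_{n+k}a_k\Big)z^n,\quad z\in\mathbb D;$$ $\mathcal H_\mu f$ is well defined if the inner series converge and the resulting power series defines an analytic function in $\mathbb D$. Saying that $\mathcal H_\mu$ maps a space $X$ into a space $Y$ includes that $\mathcal H_\mu f$ is well defined for every $f\in X$. For $\alpha\ge0$ and $s>0$, a finite positive Borel measure $\mu$ on $[0,1)$ is an $\alpha$-logarithmic $s$-Carleson measure if there is a constant $C>0$ such that $\mu([t,1))\left(\log\frac{1}{1-t}\right)^{\alpha}\le C(1-t)^s$ for all $0\le t<1$. *)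

(* Defs.v *)
From mathcomp Require Import all_boot all_order all_algebra.
From mathcomp Require Import all_classical all_reals all_analysis.
From mathcomp.real_closed Require Import complex.
Import Order.TTheory GRing.Theory Num.Theory.
Import numFieldNormedType.Exports.

Set Implicit Arguments.
Unset Strict Implicit.
Unset Printing Implicit Defensive.

Local Open Scope classical_set_scope.
Local Open Scope ring_scope.
Local Open Scope complex_scope.

(* The R-valued modulus: the norm `|z| of the library takes its values in
   R[i]. *)
Definition cmod (R : realType) (z : R[i]) : R := ComplexField.Normc.normc z.

Definition unit_disc (R : realType) : set R[i] := [set z | cmod z < 1].

(* R[i]^o carries the topology of R[i] seen as a normed space over itself, so
   derivability is complex differentiability. Values of f outside the disc are
   irrelevant since the disc is open. *)
Definition analytic_in_disc (R : realType) (f : R[i]^o -> R[i]^o) : Prop :=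
  forall z : R[i]^o, unit_disc z -> derivable f z 1.

Definition has_power_series (R : realType) (f : R[i]^o -> R[i]^o)
    (a : nat -> R[i]^o) : Prop :=
  forall z : R[i]^o, unit_disc z ->
    series (fun k => a k * z ^+ k : R[i]^o) @ \oo --> f z.

Definition integral_mean1 (R : realType) (f : R[i]^o -> R[i]^o) (r : R) :
    \bar R :=
  ((2 * pi)^-1%:E *
   \int[@lebesgue_measure R]_(t in `[0%R, (2 * pi)%R])
     (cmod (f ((r * cos t) +i* (r * sin t))))%:E)%E.

Definition hardy1 (R : realType) : set (R[i]^o -> R[i]^o) :=
  [set f | analytic_in_disc f /\
     (ereal_sup [set integral_mean1 f r | r in `]0%R, 1%R[] < +oo)%E].

(* Integration over the disc for the normalized area dx dy / pi. *)
Definition area_integral (R : realType) (F : R[i] -> R) : \bar R :=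
  (pi^-1%:E *
   \int[(@lebesgue_measure R \x @lebesgue_measure R)]_(p in
       [set p | unit_disc (p.1 +i* p.2)]) (F (p.1 +i* p.2))%:E)%E.

Definition dirichlet1_log (R : realType) (b : R) : set (R[i]^o -> R[i]^o) :=
  [set f | analytic_in_disc f /\
     (area_integral (fun z : R[i] =>
        (cmod (derive1 f z) * ln (2 / (1 - cmod z)) `^ b)%R) < +oo)%E].

(* A finite positive Borel measure on [0, 1) is a finite measure on the Borel
   sets of R that does not charge the complement of [0, 1). *)
Definition carried_by_01 (R : realType)
    (mu : {finite_measure set (measurableTypeR R) -> \bar R}) : Prop :=
  mu (~` `[0%R, 1%R[) = 0%E.

Definition log_carleson (R : realType) (alpha s : R)
    (mu : {finite_measure set (measurableTypeR R) -> \bar R}) : Prop :=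
  exists2 C : R, 0 < C & forall t : R, 0 <= t < 1 ->
    (mu `[t, 1%R[%classic * (ln (1 / (1 - t)) `^ alpha)%:E
       <= (C * (1 - t) `^ s)%:E)%E.

Definition moment (R : realType)
    (mu : {finite_measure set (measurableTypeR R) -> \bar R}) (n : nat) : R :=
  \int[mu]_(t in `[0%R, 1%R[) (t ^+ n).

Section Hankel.
Variables (R : realType)
  (mu : {finite_measure set (measurableTypeR R) -> \bar R}).

Definition hankel_row (a : nat -> R[i]^o) (n : nat) : nat -> R[i]^o :=
  fun k => (moment mu (n + k))%:C * a k.

Definition hankel_coef (a : nat -> R[i]^o) (n : nat) : R[i]^o :=
  limn (series (hankel_row a n)).

(* Meaningful when hankel_well_defined holds. *)
Definition hankel (a : nat -> R[i]^o) (z : R[i]^o) : R[i]^o :=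
  limn (series (fun n => hankel_coef a n * z ^+ n : R[i]^o)).

Definition hankel_well_defined (a : nat -> R[i]^o) : Prop :=
  [/\ forall n, cvgn (series (hankel_row a n)),
      has_power_series (hankel a) (hankel_coef a) &
      analytic_in_disc (hankel a)].

(* The operator acts on f through its Taylor coefficients a at 0, which exist
   and are unique when f is analytic in the disc. *)
Definition hankel_maps (X Y : set (R[i]^o -> R[i]^o)) : Prop :=
  forall (f : R[i]^o -> R[i]^o) (a : nat -> R[i]^o),
    X f -> has_power_series f a -> hankel_well_defined a /\ Y (hankel a).

End Hankel.

(* Main.v *)
(* Everything rests on Hardy's inequality sum |a_k|/(k+1) <= C ||f||_1 for the
   Taylor coefficients of f in H^1. It is proved for polynomials by writing
   p = g h, up to a small error on the unit circle, with |g|^2 and |h|^2 about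
   |p|: each root contributes a truncated binomial series of a square root, and
   roots inside the disc are reflected. Hilbert's inequality applied to the
   coefficients of g and h, together with Bessel's inequality, gives the bound;
   a general f is reduced to polynomials by dilation and truncation.

   Let I_i = [1 - 2^-i, 1 - 2^-(i+1)). The derivative of H_mu f is bounded by the
   integral over [0,1) of sum_k |a_k| t^k / |1 - t z|^2 dmu(t). For t in I_i the
   weight log^(alpha-1)(2/(1-|z|)) divided by |1 - t z|^2 is at most a constant
   times sum_(j <= i) (j+1)^(alpha-1) 4^j 1_(Q_j), where Q_j is the square of
   half-side 2^(1-j) centred at 1, whose area is 16/4^j. Integrating over the
   disc leaves sum_i mu(I_i) (i+1)^alpha sum_k |a_k| (1 - 2^-(i+1))^k; the
   Carleson condition bounds mu(I_i) (i+1)^alpha by C 2^-i, and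
   sum_i 2^-i (1 - 2^-(i+1))^k <= 4/(k+1) brings back Hardy's inequality. *)
Require Import Defs.
From mathcomp Require Import all_boot all_order all_algebra.
From mathcomp Require Import all_classical all_reals all_analysis.
From mathcomp Require Import measurable_realfun.
From mathcomp.real_closed Require Import complex.
From mathcomp Require Import ring lra.
Import Order.TTheory GRing.Theory Num.Theory.
Import numFieldNormedType.Exports.

Set Implicit Arguments.
Unset Strict Implicit.
Unset Printing Implicit Defensive.

Local Open Scope classical_set_scope.
Local Open Scope ring_scope.
Local Open Scope complex_scope.

(** * The real-valued complex modulus *)

Section Modulus.
Variable R : realType.
Implicit Types (x y z : R[i]) (t : R).

Lemma normc_cmod z : `|z| = (cmod z)%:C.
Proof. by rewrite normc_def; case: z. Qed.

Lemma cmod_ge0 z : 0 <= cmod z.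
Proof. by rewrite -ler0c -normc_cmod. Qed.
Hint Resolve cmod_ge0 : core.

Lemma cmodM x y : cmod (x * y) = cmod x * cmod y.
Proof. exact: ComplexField.Normc.normcM. Qed.

Lemma cmod_le_add x y : cmod (x + y) <= cmod x + cmod y.
Proof. exact: le_normcD. Qed.

Lemma cmodN z : cmod (- z) = cmod z.
Proof. exact: normcN. Qed.

Lemma cmod_dist x y : cmod (x - y) = cmod (y - x).
Proof. by rewrite -cmodN opprB. Qed.

Lemma cmod_le_sub x y : cmod (x - y) <= cmod x + cmod y.
Proof. by rewrite (le_trans (cmod_le_add _ _))// cmodN. Qed.

Lemma cmod_real t : cmod t%:C = `|t|.
Proof. by rewrite /cmod /= expr0n /= addr0 sqrtr_sqr. Qed.

Lemma cmod_natr n : cmod (n%:R : R[i]) = n%:R.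
Proof. by rewrite -(rmorph_nat (real_complex R)) cmod_real ger0_norm. Qed.

Lemma cmod0 : cmod (0 : R[i]) = 0.
Proof. exact: ComplexField.Normc.normc0. Qed.

Lemma cmod1 : cmod (1 : R[i]) = 1.
Proof. exact: ComplexField.Normc.normc1. Qed.

Lemma cmod_eq0 z : (cmod z == 0) = (z == 0).
Proof. by rewrite -(normr_eq0 z) normc_cmod -(inj_eq (@complexI R)). Qed.

Lemma cmodX z n : cmod (z ^+ n) = cmod z ^+ n.
Proof. by elim: n => [|n IHn]; rewrite ?expr0 ?cmod1// !exprS cmodM IHn. Qed.

Lemma cmodV z : cmod z^-1 = (cmod z)^-1.
Proof. exact: ComplexField.Normc.normcV. Qed.

Lemma cmodJ z : cmod z^* = cmod z.
Proof. by apply: complexI; rewrite -!normc_cmod normcJ. Qed.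

Lemma mulcJ_cmod z : z * z^* = (cmod z ^+ 2)%:C.
Proof. by rewrite -sqr_normc normc_cmod rmorphXn. Qed.

Lemma Re_le_cmod z : complex.Re z <= cmod z.
Proof.
rewrite (le_trans (ler_norm _))//; case: z => a b /=.
by rewrite /cmod/= -sqrtr_sqr ler_wsqrtr// lerDl sqr_ge0.
Qed.

Lemma cmod_sum (I : Type) (r : seq I) (P : pred I) (F : I -> R[i]) :
  cmod (\sum_(i <- r | P i) F i) <= \sum_(i <- r | P i) cmod (F i).
Proof.
elim/big_rec2: _ => [|i u v _ uv]; first by rewrite cmod0.
by rewrite (le_trans (cmod_le_add _ _))// lerD2l.
Qed.

Lemma cmodBr_triangle x y z : cmod (x - z) <= cmod (x - y) + cmod (y - z).
Proof. by rewrite (le_trans _ (cmod_le_add _ _))// addrA subrK. Qed.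

Lemma cmod_addr_sub x y : cmod x <= cmod y + cmod (x - y).
Proof. by rewrite (le_trans _ (cmod_le_add _ _))// addrC subrK. Qed.

End Modulus.

(** * Hilbert's inequality *)

Section HilbertInequality.
Variable R : rcfType.
Local Notation sq k := (Num.sqrt (k.+1%:R : R)).

(** Row sums of the Hilbert matrix against the weights 1 / sqrt (j+1), in the form required by
    Schur's test. *)
Lemma sum_hilbert_kernel (i n : nat) :
  \sum_(0 <= j < n) ((i + j).+1%:R * sq j)^-1 <= 8 / sq i.
Proof.
set m := sq i.
have m0 : 0 < m by rewrite sqrtr_gt0 ltr0n.
have m2 : m ^+ 2 = i.+1%:R by rewrite sqr_sqrtr// ler0n.
(* This sharper bound can be proved by induction: with r = sqrt n and s = sqrt (n+1), the right side
   grows by 8 / ((s + r) (s + m) (r + m)), which dominates the new term because s + r <= 2 s and (s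
   + m) (r + m) <= 4 (m^2 + n). *)
suff H : \sum_(0 <= j < n) ((i + j).+1%:R * sq j)^-1
    <= 8 / m * (Num.sqrt n%:R / (Num.sqrt n%:R + m)).
  rewrite (le_trans H)// -[leRHS]mulr1 ler_wpM2l ?divr_ge0 ?ltW//.
  have r0 : 0 <= Num.sqrt (n%:R : R) by rewrite sqrtr_ge0.
  by rewrite ltr_pdivrMr ?mul1r ?ltrDl ?ltr_wpDl.
elim: n => [|n IHn]; first by rewrite big_nil sqrtr0 !mul0r mulr0.
rewrite big_nat_recr//= (le_trans (lerD IHn (lexx _)))// -lerBrDl -mulrBr.
set r := Num.sqrt n%:R; set s := sq n.
have r0 : 0 <= r by rewrite sqrtr_ge0.
have s0 : 0 < s by rewrite sqrtr_gt0 ltr0n.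
have r2 : r ^+ 2 = n%:R by rewrite sqr_sqrtr// ler0n.
have s2 : s ^+ 2 = n%:R + 1 by rewrite sqr_sqrtr ?ler0n// natr1.
have rs : r <= s by rewrite ler_wsqrtr// ler_nat.
have srE : (s - r) * (s + r) = 1 by rewrite -subr_sqr s2 r2; ring.
have sr0 : 0 < s + r by rewrite ltr_wpDr.
have sm0 : 0 < s + m by rewrite addr_gt0.
have rm0 : 0 < r + m by rewrite ltr_wpDl.
have -> : 8 / m * (s / (s + m) - r / (r + m)) =
    8 / ((s + r) * ((s + m) * (r + m))).
  have -> : s / (s + m) - r / (r + m) = m * (s - r) / ((s + m) * (r + m)).
    by field; rewrite !gt_eqF.
  have -> : s - r = (s + r)^-1.
    by apply: (mulIf (x := s + r)); rewrite ?srE ?mulVf// gt_eqF.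
  by field; rewrite !gt_eqF.
have N0 : 0 < (i + n).+1%:R :> R by rewrite ltr0n.
have NE : (i + n).+1%:R = m ^+ 2 + n%:R :> R.
  by rewrite m2 -natrD addSn.
have NI : s ^+ 2 <= m ^+ 2 + n%:R.
  by rewrite s2 m2 addrC lerD2r ler1n.
have n0 : 0 <= n%:R :> R by rewrite ler0n.
rewrite NE -[leLHS]mul1r ler_pdivrMr ?mulr_gt0 -?NE// mulrAC ler_pdivlMr; last first.
  by rewrite !mulr_gt0.
rewrite mul1r NE.
have H1 : s + r <= 2 * s by lra.
have H2 : (s + m) * (r + m) <= 4 * (m ^+ 2 + n%:R).
  apply: (@le_trans _ _ ((s + m) * (s + m))); first by rewrite ler_pM2l// lerD2r.
  have sm2 : 0 <= (s - m) ^+ 2 by rewrite sqr_ge0.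
  nra.
apply: (@le_trans _ _ ((2 * s) * (4 * (m ^+ 2 + n%:R)))); last lra.
by rewrite ler_pM// ?mulr_ge0// ltW.
Qed.

(** Schur's test. The arithmetic-geometric mean inequality with weights sqrt (i+1) and sqrt (j+1)
    splits each term into a part in x_i^2 and a part in y_j^2, both summed by [sum_hilbert_kernel];
    the halves turn 8 into 4. *)
Lemma hilbert_inequality (x y : nat -> R) (n : nat) :
  \sum_(0 <= i < n) \sum_(0 <= j < n) x i * y j / (i + j).+1%:R
  <= 4 * (\sum_(0 <= i < n) x i ^+ 2 + \sum_(0 <= i < n) y i ^+ 2).
Proof.
have s0 k : 0 < sq k by rewrite sqrtr_gt0 ltr0n.
pose A i j := x i ^+ 2 * sq i / 2 * ((i + j).+1%:R * sq j)^-1.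
pose B j i := y j ^+ 2 * sq j / 2 * ((j + i).+1%:R * sq i)^-1.
have AB i j : x i * y j / (i + j).+1%:R <= A i j + B j i.
  have N0 : 0 < (i + j).+1%:R :> R by rewrite ltr0n.
  rewrite /A /B [(j + i)%N]addnC.
  have := s0 i; have := s0 j; move: (sq i) (sq j) => a b b0 a0.
  have -> : x i ^+ 2 * a / 2 * ((i + j).+1%:R * b)^-1 +
     y j ^+ 2 * b / 2 * ((i + j).+1%:R * a)^-1 =
     ((x i * a) ^+ 2 + (y j * b) ^+ 2) / (2 * a * b) / (i + j).+1%:R.
     by field; rewrite !gt_eqF // ?nat1r ?natr1 -?natrD ?addnS.
  rewrite ler_pM2r ?invr_gt0// ler_pdivlMr ?mulr_gt0//.
  have xy2 : 0 <= (x i * a - y j * b) ^+ 2 by rewrite sqr_ge0.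
  nra.
have sumA z : \sum_(0 <= i < n) \sum_(0 <= j < n)
    (z i ^+ 2 * sq i / 2 * ((i + j).+1%:R * sq j)^-1) <=
    4 * (\sum_(0 <= i < n) z i ^+ 2).
  rewrite mulr_sumr ler_sum// => i _.
  rewrite -mulr_sumr (le_trans (ler_wpM2l _ (sum_hilbert_kernel i n)))//.
    by rewrite divr_ge0// mulr_ge0 ?sqr_ge0// ltW.
  by rewrite le_eqVlt; apply/orP; left; apply/eqP; field; rewrite gt_eqF.
rewrite mulrDr (le_trans _ (lerD (sumA x) (sumA y)))//.
rewrite [X in _ <= _ + X]exchange_big/= -big_split/= ler_sum// => i _.
by rewrite -big_split/= ler_sum// => j _; exact: AB.
Qed.

End HilbertInequality.

(** Rewrites a truncated Cauchy product as a sum over the triangle i + j < n, ready for comparison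
    with the full square. *)
Lemma sum_antidiagonal (V : nmodType) (F : nat -> nat -> V) (n : nat) :
  \sum_(0 <= k < n) \sum_(0 <= i < k.+1) F i (k - i)%N
  = \sum_(0 <= i < n) \sum_(0 <= j < n - i) F i j.
Proof.
transitivity (\sum_(0 <= i < n) \sum_(i <= k < n) F i (k - i)%N).
  elim: n => [|n IHn]; first by rewrite !big_nil.
  rewrite big_nat_recr//= IHn [RHS]big_nat_recr//= big_nat1.
  rewrite [X in _ + X]big_nat_recr//= addrA -big_split/=; congr (_ + _).
  by apply: eq_big_nat => i /andP[_ /ltnW ni]; rewrite [RHS]big_nat_recr.
apply: eq_big_nat => i _; rewrite -{1}(add0n i) big_addn.
by under eq_bigr do rewrite addnK.
Qed.

(** * Factorization of polynomials on the unit circle *)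

Section SquareRootSeries.
Variable R : realType.

(* Taylor coefficients of (1 - u)^(-1/2). *)
Fixpoint isqrt_coef (k : nat) : R :=
  if k is k'.+1 then isqrt_coef k' * (k'.*2.+1%:R / k'.*2.+2%:R) else 1.
Local Notation c := isqrt_coef.

Lemma isqrt_coef_ge0 k : 0 <= c k.
Proof. by elim: k => //= k IHk; rewrite mulr_ge0// divr_ge0. Qed.

Lemma isqrt_coef_le1 k : c k <= 1.
Proof.
elim: k => //= k IHk; rewrite -[leRHS]mul1r ler_pM ?isqrt_coef_ge0 ?divr_ge0//.
by rewrite ler_pdivrMr ?ltr0n// mul1r ler_nat.
Qed.

Lemma isqrt_coefS k : k.+1%:R * c k.+1 = (k%:R + 1 / 2) * c k.
Proof.
have -> : c k.+1 = c k * (k.*2.+1%:R / k.*2.+2%:R) by [].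
have -> : k.*2.+2%:R = 2 * k.+1%:R :> R by rewrite -natrM mul2n doubleS.
have -> : k.*2.+1%:R = 2 * k%:R + 1 :> R by rewrite -natr1 -mul2n natrM.
by field; rewrite addrC natr1 pnatr_eq0.
Qed.

(** The square of (1 - u)^(-1/2) is the geometric series. Call the convolution S_k; the recurrence
    [isqrt_coefS] yields (k+1) S_(k+1) = (k+1) S_k. *)
Lemma isqrt_conv k : \sum_(0 <= i < k.+1) c i * c (k - i)%N = 1.
Proof.
pose S k := \sum_(0 <= i < k.+1) c i * c (k - i)%N.
rewrite -/(S k); elim: k => [|k IHk]; first by rewrite /S big_nat1 mulr1.
have flip m (G : nat -> nat -> R) :
    \sum_(0 <= i < m.+1) G i (m - i)%N = \sum_(0 <= i < m.+1) G (m - i)%N i.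
  rewrite big_nat_rev/=; apply: eq_big_nat => i /andP[_ im].
  by rewrite add0n subSS subKn.
(* The weight m = i + (m - i) is shared equally between the two factors, by symmetry. *)
have dS m : m%:R * S m = 2 * \sum_(0 <= i < m.+1) i%:R * c i * c (m - i)%N.
  rewrite mulr2n mulrDl mul1r {2}(flip m (fun i j => i%:R * c i * c j)).
  rewrite -big_split mulr_sumr; apply: eq_big_nat => i /andP[_ im] /=.
  by rewrite -{1}(subnKC (n := m) (m := i)) // natrD; ring.
have : k.+1%:R * S k.+1 = k.+1%:R * S k.
  rewrite dS big_nat_recl//= mul0r mul0r add0r.
  under eq_bigr do rewrite isqrt_coefS subSS mulrDl mulrDl.
  rewrite big_split/= mulrDr -dS.
  have -> : k.+1%:R * S k = k%:R * S k + S k by rewrite -natr1 mulrDl mul1r.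
  congr (_ + _).
  by rewrite /S mulr_sumr; apply: eq_bigr => i _; field.
by rewrite IHk => /(mulfI _)->//; rewrite pnatr_eq0.
Qed.

Definition isqrt_poly (N : nat) : {poly R[i]} := \poly_(i < N) (c i)%:C.

Lemma horner_isqrt_poly N (u : R[i]) :
  (isqrt_poly N).[u] = \sum_(0 <= i < N) (c i)%:C * u ^+ i.
Proof. by rewrite horner_poly big_mkord. Qed.

(** In the squared polynomial the terms of degree below N form exactly the geometric sum [geo]. The
    other terms, at most N^2 of them, have coefficients at most 1 and degree at least N. The factor
    |1 - u| <= 2 and the remainder u^N of the geometric sum account for the constants. *)
Lemma isqrt_poly_approx N (u : R[i]) (r : R) : cmod u <= r -> r <= 1 ->
  cmod ((1 - u) * (isqrt_poly N).[u] ^+ 2 - 1) <= (2 * N%:R ^+ 2 + 1) * r ^+ N.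
Proof.
move=> ur r1; have r0 : 0 <= r by rewrite (le_trans _ ur)// cmod_ge0.
pose geo := \sum_(0 <= k < N) u ^+ k.
have geoE : (1 - u) * geo = 1 - u ^+ N.
  by apply: oppr_inj; rewrite -mulNr !opprB subrX1 /geo big_mkord.
pose F i j := (c i)%:C * (c j)%:C * u ^+ (i + j).
have sqE : (isqrt_poly N).[u] ^+ 2 =
    \sum_(0 <= i < N) \sum_(0 <= j < N) F i j.
  rewrite expr2 horner_isqrt_poly mulr_suml; apply: eq_bigr => i _.
  by rewrite mulr_sumr; apply: eq_bigr => j _; rewrite /F exprD; ring.
have geoF : geo = \sum_(0 <= i < N) \sum_(0 <= j < N - i) F i j.
  rewrite /geo -sum_antidiagonal; apply/esym; apply: eq_big_nat => k _.
  under eq_big_nat => i /andP[_ ik].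
    rewrite /F subnKC// -rmorphM/=; over.
  by rewrite -mulr_suml -rmorph_sum/= isqrt_conv rmorph1 mul1r.
have diff : cmod ((isqrt_poly N).[u] ^+ 2 - geo) <= N%:R ^+ 2 * r ^+ N.
  have -> : (isqrt_poly N).[u] ^+ 2 - geo =
      \sum_(0 <= i < N) \sum_(N - i <= j < N) F i j.
    rewrite sqE geoF -sumrB; apply: eq_big_nat => i _.
    by rewrite (@big_cat_nat _ _ _ (N - i)%N 0 N)//= ?leq_subr// addrAC subrr add0r.
  have F_le i j : (N - i <= j)%N -> cmod (F i j) <= r ^+ N.
    move=> Nij; rewrite /F !cmodM cmodX !cmod_real !ger0_norm ?isqrt_coef_ge0//.
    rewrite -[leRHS]mul1r ler_pM//.
    - by rewrite mulr_ge0 ?isqrt_coef_ge0.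
    - by rewrite exprn_ge0// cmod_ge0.
    - by rewrite -[leRHS]mul1r ler_pM ?isqrt_coef_ge0 ?isqrt_coef_le1.
    rewrite (@le_trans _ _ (r ^+ (i + j)))// ?lerXn2r ?nnegrE ?cmod_ge0//.
    by rewrite ler_wiXn2l// -leq_subLR.
  rewrite (le_trans (cmod_sum _ _ _))//.
  rewrite (@le_trans _ _ (\sum_(0 <= i < N) N%:R * r ^+ N))//; last first.
    by rewrite sumr_const_nat subn0 -[leLHS]mulr_natl mulrA -expr2.
  apply: ler_sum_nat => i /andP[_ /ltnW iN].
  rewrite (le_trans (cmod_sum _ _ _))//.
  rewrite (@le_trans _ _ (\sum_(N - i <= j < N) r ^+ N))//.
    by apply: ler_sum_nat => j /andP[+ _]; exact: F_le.
  rewrite sumr_const_nat subKn// -[leLHS]mulr_natl ler_wpM2r ?exprn_ge0//.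
  by rewrite ler_nat.
have -> : (1 - u) * (isqrt_poly N).[u] ^+ 2 - 1 =
    (1 - u) * ((isqrt_poly N).[u] ^+ 2 - geo) - u ^+ N.
  by rewrite mulrBr geoE; ring.
rewrite (le_trans (cmod_le_sub _ _))// cmodM cmodX [leRHS]mulrDl mul1r lerD//.
  rewrite -mulrA ler_pM//; rewrite ?cmod_ge0// (le_trans (cmod_le_sub _ _))// cmod1.
  by rewrite lerD2l (le_trans ur).
by rewrite lerXn2r ?nnegrE ?cmod_ge0.
Qed.

End SquareRootSeries.

(** With s = sqrt r and r^n = s^n s^n, one copy absorbs a factor n, since n s^n <= 1 + s + ... +
    s^(n-1) <= 1 / (1 - s); the other is left to the induction on m. *)
Lemma natX_geometric_bounded (R : realType) (m : nat) (r : R) :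
  0 <= r -> r < 1 -> exists2 B : R, 0 < B & forall n, n%:R ^+ m * r ^+ n <= B.
Proof.
elim: m r => [|m IHm] r r0 r1.
  by exists 1 => // n; rewrite expr0 mul1r exprn_ile1// ltW.
have s0 : 0 <= Num.sqrt r by rewrite sqrtr_ge0.
have s1 : Num.sqrt r < 1 by rewrite -sqrtr1 ltr_sqrt.
have [B B0 HB] := IHm _ s0 s1.
have s1' : 0 < 1 - Num.sqrt r by rewrite subr_gt0.
exists ((1 - Num.sqrt r)^-1 * B) => [|n]; first by rewrite mulr_gt0 ?invr_gt0.
have -> : r ^+ n = Num.sqrt r ^+ n * Num.sqrt r ^+ n.
  by rewrite -exprMn -expr2 sqr_sqrtr.
rewrite exprS mulrACA ler_pM ?mulr_ge0 ?exprn_ge0//.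
rewrite -[(_)^-1]mul1r ler_pdivlMr//.
have -> : n%:R * Num.sqrt r ^+ n = \sum_(i < n) Num.sqrt r ^+ n.
  by rewrite sumr_const card_ord -[RHS]mulr_natl.
rewrite (@le_trans _ _ ((\sum_(i < n) Num.sqrt r ^+ i) * (1 - Num.sqrt r)))//.
  rewrite ler_pM2r// ler_sum// => i _.
  by rewrite ler_wiXn2l ?(ltW s1)// ltnW.
by rewrite mulrC -opprB mulNr -subrX1 opprB gerBl exprn_ge0.
Qed.

(** * Factorization with balanced moduli, root by root *)

Section ApproximateFactorization.
Variable R : realType.
Implicit Types (p q g h : {poly R[i]}) (z w : R[i]).

(* Finite stand-in for the factorization p = q^(1/2) (p / q^(1/2)), where q is
   obtained from p by reflecting the roots of the open disc, so that q is
   zero-free there and |q| = |p| on the circle. *)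
Definition balanced_factorization p : Prop :=
  forall e : R, 0 < e -> exists g h, forall z, cmod z = 1 ->
    [/\ cmod (g.[z] * h.[z] - p.[z]) <= e,
        cmod g.[z] ^+ 2 <= cmod p.[z] + e &
        cmod h.[z] ^+ 2 <= cmod p.[z] + e].

Lemma horner_unit_circle_bounded p :
  exists2 B : R, 0 < B & forall z, cmod z = 1 -> cmod p.[z] <= B.
Proof.
exists (1 + \sum_(i < size p) cmod p`_i) => [|z z1].
  by rewrite ltr_pwDl// sumr_ge0// => i _; exact: cmod_ge0.
rewrite horner_coef (le_trans (cmod_sum _ _ _))// -[leLHS]add0r lerD//.
by apply: ler_sum => i _; rewrite cmodM cmodX z1 expr1n mulr1.
Qed.

Lemma balanced_factorizationM p q : balanced_factorization p ->
  balanced_factorization q -> balanced_factorization (p * q).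
Proof.
move=> fp fq e e0.
have [A A0 HA] := horner_unit_circle_bounded p.
have [B B0 HB] := horner_unit_circle_bounded q.
pose K := A + B + 1; have K0 : 0 < K by rewrite !addr_gt0.
(* The bound d <= 1 reduces the quadratic error d^2 to d, so that the total error is at most d (A +
   B + 1) <= e. *)
pose d := Num.min 1 (e / K).
have d0 : 0 < d by rewrite lt_min ltr01 divr_gt0.
have d1 : d <= 1 by rewrite ge_min lexx.
have dK : d * K <= e by rewrite -ler_pdivlMr// ge_min lexx orbT.
have [g1 [h1 H1]] := fp d d0; have [g2 [h2 H2]] := fq d d0.
exists (g1 * g2), (h1 * h2) => z z1; rewrite !hornerM !cmodM !exprMn.
have [e1 G1 K1] := H1 z z1; have [e2 G2 K2] := H2 z z1.
have bp := HA z z1; have bq := HB z z1.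
have p0 := cmod_ge0 p.[z]; have q0 := cmod_ge0 q.[z].
have prod x y : 0 <= x -> 0 <= y -> x <= cmod p.[z] + d ->
    y <= cmod q.[z] + d -> x * y <= cmod p.[z] * cmod q.[z] + e.
  move=> x0 y0 xp yq; apply: (le_trans (ler_pM x0 y0 xp yq)).
  move: p0 q0 bp bq; rewrite /K in dK.
  by move: (cmod p.[z]) (cmod q.[z]) => P Q P0 Q0 PA QB; nra.
split; last 2 first.
- by apply: prod; rewrite ?sqr_ge0.
- by apply: prod; rewrite ?sqr_ge0.
have -> : g1.[z] * g2.[z] * (h1.[z] * h2.[z]) - p.[z] * q.[z] =
    (g1.[z] * h1.[z] - p.[z]) * (g2.[z] * h2.[z] - q.[z]) +
    (g1.[z] * h1.[z] - p.[z]) * q.[z] + p.[z] * (g2.[z] * h2.[z] - q.[z]).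
  by ring.
rewrite (le_trans (cmod_le_add _ _))// (le_trans (lerD (cmod_le_add _ _) (lexx _)))//.
rewrite !cmodM; move: e1 e2 p0 q0 bp bq; rewrite /K in dK.
have := cmod_ge0 (g1.[z] * h1.[z] - p.[z]).
have := cmod_ge0 (g2.[z] * h2.[z] - q.[z]).
move: (cmod (_ - p.[z])) (cmod (_ - q.[z])) (cmod p.[z]) (cmod q.[z]).
move=> E1 E2 P Q E20 E10 E1d E2d P0 Q0 PA QB.
have : E1 * E2 <= d * 1 by rewrite ler_pM// (le_trans E2d).
have : E1 * Q <= d * B by rewrite ler_pM.
have : P * E2 <= A * d by rewrite ler_pM.
lra.
Qed.

(** Closedness under uniform limits on the circle; it serves for roots lying on the circle
    itself. *)
Lemma balanced_factorization_lim p :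
  (forall e : R, 0 < e -> exists2 q, balanced_factorization q &
     forall z, cmod z = 1 -> cmod (p.[z] - q.[z]) <= e) ->
  balanced_factorization p.
Proof.
move=> H e e0; have e20 : 0 < e / 2 by rewrite divr_gt0.
have [q fq pq] := H _ e20; have [g [h Hgh]] := fq _ e20.
exists g, h => z z1; have [e1 G1 K1] := Hgh z z1; have := pq z z1.
rewrite cmod_dist => qp; have := cmod_addr_sub q.[z] p.[z].
split; [|lra|lra].
by rewrite (le_trans (cmodBr_triangle _ q.[z] _))//; lra.
Qed.

Lemma balanced_factorizationC (c : R[i]) : balanced_factorization c%:P.
Proof.
move=> e e0; exists (sqrtc c)%:P, (sqrtc c)%:P => z _; rewrite !hornerC.
rewrite -cmodX -expr2 sqr_sqrtc subrr cmod0; split => //; first exact: ltW.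
all: by rewrite lerDl ltW.
Qed.

Lemma isqrt_poly_approx_lim (r : R) : 0 <= r -> r < 1 ->
  forall e : R, 0 < e -> exists N, forall u : R[i], cmod u <= r ->
    cmod ((1 - u) * (isqrt_poly R N).[u] ^+ 2 - 1) <= e.
Proof.
move=> r0 r1 e e0; have [B B0 HB] := natX_geometric_bounded 3 r0 r1.
(* The cubic bound N^3 r^N <= B leaves a spare factor 1 / N: the error (2 N^2 + 1) r^N is at most 3
   B / N <= e. *)
pose N := (Num.truncn (3 * B / e)).+1; exists N => u ur.
rewrite (le_trans (isqrt_poly_approx N ur (ltW r1)))//.
have N0 : 0 < N%:R :> R by rewrite ltr0n.
have N1 : 1 <= N%:R :> R by rewrite ler1n.
rewrite -(ler_pM2l N0) (@le_trans _ _ (3 * B))//; last first.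
  by rewrite -ler_pdivrMr// ltW// truncnS_gt.
rewrite (@le_trans _ _ (3 * (N%:R ^+ 3 * r ^+ N)))//; last by rewrite ler_pM2l.
rewrite !mulrA ler_wpM2r ?exprn_ge0//.
move: (N%:R) N1 {N0} => n n1; have n2 : 1 <= n ^+ 2 by rewrite expr_ge1// (le_trans _ n1).
nra.
Qed.

(* For |w| > 1 both factors approximate (z - w)^(1/2); for |w| < 1 they
   approximate (1 - conj(w) z)^(1/2) and (z - w) / (1 - conj(w) z)^(1/2), since
   |z - w| = |1 - conj(w) z| on the circle. *)
Lemma balanced_factorization_XsubC w : balanced_factorization ('X - w%:P).
Proof.
have gt1 v : 1 < cmod v -> balanced_factorization ('X - v%:P).
  move=> v1; have v0 : v != 0 by rewrite -cmod_eq0 gt_eqF// (lt_trans _ v1).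
  have cv0 : 0 < cmod v by rewrite (lt_trans _ v1).
  have r0 : 0 <= (cmod v)^-1 by rewrite invr_ge0 cmod_ge0.
  have r1 : (cmod v)^-1 < 1 by rewrite invf_lt1.
  move=> e e0; have d0 : 0 < e / (1 + cmod v).
    by rewrite divr_gt0// addr_gt0.
  have [N HN] := isqrt_poly_approx_lim r0 r1 d0.
  pose u : {poly R[i]} := v^-1 *: 'X.
  (* Since - v (1 - u) = z - v, the square of g is z - v times (1 - u) S^2, which is close to 1; g
     serves as both factors. *)
  pose g := (sqrtc (- v))%:P * (1 - u) * (isqrt_poly R N \Po u).
  have gE z : cmod z = 1 -> cmod (g.[z] ^+ 2 - ('X - v%:P).[z]) <= e.
    move=> z1; have uz : cmod (v^-1 * z) <= (cmod v)^-1.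
      by rewrite cmodM z1 mulr1 cmodV.
    have := HN _ uz; move=> Hz.
    rewrite /g !hornerE horner_comp !hornerE.
    have -> : (sqrtc (- v) * (1 - v^-1 * z) * (isqrt_poly R N).[v^-1 * z]) ^+ 2
       - (z - v) = (z - v) *
         ((1 - v^-1 * z) * (isqrt_poly R N).[v^-1 * z] ^+ 2 - 1).
      rewrite !exprMn sqr_sqrtc; move: (_.[_]) => S; field; exact: v0.
    rewrite cmodM (@le_trans _ _ ((1 + cmod v) * (e / (1 + cmod v))))//.
      rewrite ler_pM ?cmod_ge0// (le_trans (cmod_le_sub _ _))// z1//.
    by rewrite mulrC divfK// gt_eqF// addr_gt0.
  exists g, g => z z1; have := gE z z1; rewrite expr2 => ge.
  have := cmod_addr_sub (g.[z] * g.[z]) ('X - v%:P).[z].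
  by rewrite -cmodX expr2; split => //; lra.
have [w1|w1] := ltP 1 (cmod w); first exact: gt1.
move: w1; rewrite le_eqVlt => /orP[/eqP w1|w1].
  (* A root on the circle is pushed outside by the factor 1 + e. *)
  apply: balanced_factorization_lim => e e0.
  exists ('X - ((1 + e)%:C * w)%:P) => [|z z1].
    by apply: gt1; rewrite cmodM w1 mulr1 cmod_real ger0_norm ?addr_ge0 ?ltW// ltrDl.
  rewrite !hornerE (_ : _ - _ = e%:C * w); last by rewrite rmorphD rmorph1; ring.
  by rewrite cmodM w1 mulr1 cmod_real gtr0_norm.
move=> e e0; have d0 : 0 < e / 2 by rewrite divr_gt0.
have [N HN] := isqrt_poly_approx_lim (cmod_ge0 w) w1 d0.
pose u : {poly R[i]} := w^* *: 'X.
pose S := isqrt_poly R N \Po u.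
exists ((1 - u) * S), (('X - w%:P) * S) => z z1.
have uz : cmod (w^* * z) <= cmod w by rewrite cmodM z1 mulr1 cmodJ.
have {HN}Hz := HN _ uz.
have zw2 : cmod (z - w) <= 2.
  by rewrite (le_trans (cmod_le_sub _ _))// z1; lra.
have zwE : cmod (1 - w^* * z) = cmod (z - w).
  have -> : 1 - w^* * z = z * (z - w)^*.
    by rewrite rmorphB mulrBr mulcJ_cmod z1 expr1n mulrC.
  by rewrite cmodM z1 mul1r cmodJ.
rewrite !hornerE /S horner_comp !hornerE.
move: ((isqrt_poly R N).[_]) Hz => s Hz.
have sE : (1 - w^* * z) * s * ((z - w) * s) - (z - w) =
   (z - w) * ((1 - w^* * z) * s ^+ 2 - 1) by ring.
have H1 : cmod ((1 - w^* * z) * s * ((z - w) * s) - (z - w)) <= e.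
  rewrite sE cmodM (@le_trans _ _ (2 * (e / 2)))//.
    by rewrite ler_pM ?cmod_ge0.
  by rewrite mulrC divfK// pnatr_eq0.
have H2 := cmod_addr_sub ((1 - w^* * z) * s * ((z - w) * s)) (z - w).
(* The two factors have equal moduli on the circle, so either squared modulus is the modulus of the
   product. *)
have E1 : cmod ((1 - w^* * z) * s) ^+ 2 =
    cmod ((1 - w^* * z) * s * ((z - w) * s)).
  by rewrite !cmodM zwE; ring.
have E2 : cmod ((z - w) * s) ^+ 2 = cmod ((1 - w^* * z) * s * ((z - w) * s)).
  by rewrite !cmodM zwE; ring.
split; first by rewrite -[X in X - _]mulrA.
- by rewrite E1 (le_trans H2)// lerD2l.
- by rewrite E2 (le_trans H2)// lerD2l.
Qed.

Lemma balanced_factorization_poly p : balanced_factorization p.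
Proof.
have [r ->] := closed_field_poly_normal p.
rewrite -mul_polyC; apply: balanced_factorizationM.
  exact: balanced_factorizationC.
elim/big_ind: _ => [|q1 q2|w _].
- exact: balanced_factorizationC.
- exact: balanced_factorizationM.
- exact: balanced_factorization_XsubC.
Qed.

End ApproximateFactorization.

(** * Complex sequences and power series *)

Section ComplexSequences.
Variable R : realType.
Implicit Types (u v : nat -> R[i]^o) (l c : R[i]^o).

Lemma cvg_cmodP u l :
  u @ \oo --> l <-> forall e : R, 0 < e ->
    exists N, forall n, (N <= n)%N -> cmod (u n - l) <= e.
Proof.
split=> [/cvgrPdist_le ul e e0|ul].
  have e0C : 0 < e%:C :> R[i] by rewrite -(rmorph0 (real_complex R)) ltcR.
  have [N _ HN] := ul _ e0C; exists N => n Nn.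
  by have := HN n Nn; rewrite /= normc_cmod lecR cmod_dist.
apply/cvgrPdist_le => -[e e'] /=; rewrite ltcE/= => /andP[/eqP -> e0].
have [N HN] := ul e e0; exists N => // n /= Nn.
by rewrite normc_cmod [e +i* 0]complexr0 lecR cmod_dist HN.
Qed.

Lemma limn_cmod u l : u @ \oo --> l -> limn u = l.
Proof. exact: (cvg_lim (@norm_hausdorff _ _)). Qed.

Lemma cvg_cmod_le u l c (N : nat) (B : R) : u @ \oo --> l ->
  (forall n, (N <= n)%N -> cmod (u n - c) <= B) -> cmod (l - c) <= B.
Proof.
move=> /cvg_cmodP ul H; apply/ler_addgt0Pl => e e0.
have [M HM] := ul _ e0.
rewrite (le_trans (cmodBr_triangle _ (u (maxn N M)) _))// lerD//.
  by rewrite cmod_dist HM// leq_maxr.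
by rewrite H// leq_maxl.
Qed.

Lemma Im_le_cmod (z : R[i]) : `|complex.Im z| <= cmod z.
Proof.
by case: z => a b /=; rewrite /cmod/= -sqrtr_sqr ler_wsqrtr// lerDr sqr_ge0.
Qed.

Lemma abs_Re_le_cmod (z : R[i]) : `|complex.Re z| <= cmod z.
Proof.
by case: z => a b /=; rewrite /cmod/= -sqrtr_sqr ler_wsqrtr// lerDl sqr_ge0.
Qed.

Lemma cmod_le_Re_Im (z : R[i]) : cmod z <= `|complex.Re z| + `|complex.Im z|.
Proof.
rewrite {1}(complexE z) (le_trans (cmod_le_add _ _))// cmodM !cmod_real.
by rewrite (_ : cmod 'i = 1) ?mul1r// /cmod/= expr0n/= add0r expr1n sqrtr1.
Qed.

Lemma cvg_real_of_bounded_abs (x : nat -> R) (B : R) :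
  (forall n, \sum_(0 <= k < n) `|x k| <= B) -> cvgn (series x).
Proof.
move=> H; apply: normed_cvg; apply: nondecreasing_is_cvgn.
  exact: (@nondecreasing_series _ (fun k => `|x k|) xpredT 0).
by exists B => _ [n _ <-]; exact: H.
Qed.

Lemma abs_summable_cvg (a : nat -> R[i]^o) (B : R) :
  (forall n, \sum_(0 <= k < n) cmod (a k) <= B) ->
  exists l : R[i]^o, series a @ \oo --> l.
Proof.
move=> H.
have cr : cvgn (series (fun k => complex.Re (a k))).
  apply: (@cvg_real_of_bounded_abs _ B) => n; rewrite (le_trans _ (H n))//.
  by apply: ler_sum => k _; exact: abs_Re_le_cmod.
have ci : cvgn (series (fun k => complex.Im (a k))).
  apply: (@cvg_real_of_bounded_abs _ B) => n; rewrite (le_trans _ (H n))//.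
  by apply: ler_sum => k _; exact: Im_le_cmod.
set x := limn _ in cr; set y := limn _ in ci.
exists (x +i* y); apply/cvg_cmodP => e e0.
have e20 : 0 < e / 2 by rewrite divr_gt0.
move/cvgrPdist_le : cr => /(_ _ e20) [N _ HN].
move/cvgrPdist_le : ci => /(_ _ e20) [M _ HM].
exists (maxn N M) => n; rewrite geq_max => /andP[Nn Mn].
rewrite (le_trans (cmod_le_Re_Im _))// [leRHS]splitr lerD//.
  rewrite raddfB/= distrC /series raddf_sum; exact: HN.
rewrite raddfB/= distrC /series raddf_sum; exact: HM.
Qed.

End ComplexSequences.

(** * Coefficient bounds and uniform convergence on smaller discs *)

Section PowerSeriesBounds.
Variable R : realType.
Implicit Types (a : nat -> R[i]^o) (f : R[i]^o -> R[i]^o).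

Lemma unit_discE (z : R[i]) : unit_disc z = (cmod z < 1).
Proof. by []. Qed.

(** At the real point r, late partial sums lie within 1 of f(r), so late terms have modulus at most
    2; the finite sum takes care of the first N terms. *)
Lemma power_series_coef_bound f a (r : R) : has_power_series f a ->
  0 <= r -> r < 1 ->
  exists2 B : R, 0 < B & forall k, cmod (a k) * r ^+ k <= B.
Proof.
move=> fa r0 r1.
have disc : unit_disc (r%:C : R[i]^o) by rewrite unit_discE cmod_real ger0_norm.
have /cvg_cmodP/(_ 1 ltr01)[N HN] := fa _ disc.
exists (2 + \sum_(0 <= k < N) cmod (a k) * r ^+ k) => [|k].
  rewrite ltr_pwDl// sumr_ge0// => k _.
  by rewrite mulr_ge0 ?cmod_ge0 ?exprn_ge0.
have S0 n : 0 <= \sum_(0 <= k < n) cmod (a k) * r ^+ k.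
  by rewrite sumr_ge0// => j _; rewrite mulr_ge0 ?cmod_ge0 ?exprn_ge0.
have [kN|Nk] := ltnP k N.
  rewrite (big_cat_nat (n := k.+1))//= big_nat_recr//=.
  have rest : 0 <= \sum_(k.+1 <= j < N) cmod (a j) * r ^+ j.
    by rewrite sumr_ge0// => j _; rewrite mulr_ge0 ?cmod_ge0 ?exprn_ge0.
  have := S0 k; lra.
rewrite ler_wpDr//.
have -> : cmod (a k) * r ^+ k = cmod (a k * r%:C ^+ k).
  by rewrite cmodM cmodX cmod_real ger0_norm.
have -> : a k * r%:C ^+ k = series (fun k => a k * r%:C ^+ k : R[i]^o) k.+1 -
    series (fun k => a k * r%:C ^+ k : R[i]^o) k.
  by rewrite /series/= big_nat_recr//= addrAC subrr add0r.
rewrite (le_trans (cmodBr_triangle _ (f r%:C) _))// lerD//.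
  by rewrite HN// (leq_trans Nk).
by rewrite cmod_dist HN.
Qed.

Lemma power_series_uniform f a (r e : R) : has_power_series f a ->
  0 <= r -> r < 1 -> 0 < e ->
  exists N, forall n, (N <= n)%N -> forall z : R[i]^o, cmod z <= r ->
    cmod (f z - \sum_(0 <= k < n) a k * z ^+ k) <= e.
Proof.
(* A radius s strictly between r and 1 gives |a_k| r^k <= B q^k with q = r / s < 1. The tail from n
   on is then at most B q^n / (1 - q), and n q^n <= C makes it small uniformly. *)
move=> fa r0 r1 e0; pose s := (1 + r) / 2.
have s0 : 0 < s by rewrite /s; lra.
have s1 : s < 1 by rewrite /s; lra.
have rs : r < s by rewrite /s; lra.
have [B B0 HB] := power_series_coef_bound fa (ltW s0) s1.
pose q := r / s.
have q0 : 0 <= q by rewrite divr_ge0// ltW.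
have q1 : q < 1 by rewrite ltr_pdivrMr ?mul1r.
have [C C0 HC] := natX_geometric_bounded 1 q0 q1.
have q1' : 0 < 1 - q by rewrite subr_gt0.
pose N := (Num.truncn (B * C / (1 - q) / e)).+1; exists N => n Nn z zr.
have n0 : 0 < n%:R :> R by rewrite ltr0n (leq_trans _ Nn).
have zd : unit_disc z by rewrite unit_discE (le_lt_trans zr).
apply: (cvg_cmod_le (N := n) (fa z zd)) => m nm.
rewrite /series/= (big_cat_nat (n := n))//= addrAC subrr add0r.
rewrite (le_trans (cmod_sum _ _ _))//.
rewrite (@le_trans _ _ (\sum_(n <= k < m) B * q ^+ k))//.
  apply: ler_sum_nat => k _; rewrite cmodM cmodX /q expr_div_n mulrA.
  rewrite ler_pdivlMr ?exprn_gt0// mulrAC.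
  by rewrite ler_pM ?mulr_ge0 ?cmod_ge0 ?exprn_ge0 ?cmod_ge0 ?(ltW s0)// lerXn2r ?nnegrE ?cmod_ge0.
rewrite -mulr_sumr -(ler_pM2r q1') -(ler_pM2l n0) mulrA.
have geo : (\sum_(n <= k < m) q ^+ k) * (1 - q) <= q ^+ n.
  rewrite -{1}(add0n n) big_addn big_mkord.
  under eq_bigr do rewrite exprD.
  rewrite -mulr_suml mulrAC [X in X * _]mulrC -[X in X * _ * _]opprB mulNr -subrX1 opprB.
  by rewrite -[leRHS]mul1r ler_wpM2r ?exprn_ge0// gerBl exprn_ge0.
rewrite (@le_trans _ _ (n%:R * B * q ^+ n))//.
  by rewrite -!mulrA ler_pM2l// ler_pM2l.
rewrite (@le_trans _ _ (B * C))//.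
  by rewrite mulrAC [leRHS]mulrC ler_pM2r// -{1}[n%:R]expr1.
rewrite mulrA -ler_pdivrMr// -ler_pdivrMr//.
by rewrite (le_trans (ltW (truncnS_gt _)))// ler_nat.
Qed.

End PowerSeriesBounds.

(** * Hardy's inequality *)

Section CircleIntegrals.
Variable R : realType.
Implicit Types (p q : {poly R[i]}) (t : R).
Local Notation mu := (@lebesgue_measure R).

Definition circle t : R[i] := cos t +i* sin t.

Lemma cmod_circle t : cmod (circle t) = 1.
Proof. by rewrite /cmod/= cos2Dsin2 sqrtr1. Qed.

Lemma circle0 : circle 0 = 1.
Proof. by rewrite /circle cos0 sin0. Qed.

Lemma circle2pi : circle (2 * pi) = 1.
Proof. by rewrite /circle mulr_natl cos2pi sin2pi. Qed.

(** The derivative of p(e^(it)) is i e^(it) p'(e^(it)); it is split into real and imaginary parts to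
    stay within real calculus. *)
Lemma is_derive_horner_circle p t :
  is_derive t 1 (fun t => complex.Re p.[circle t])
    (- complex.Im (circle t * p^`().[circle t])) /\
  is_derive t 1 (fun t => complex.Im p.[circle t])
    (complex.Re (circle t * p^`().[circle t])).
Proof.
elim/poly_ind: p => [|p c [IHr IHi]].
  rewrite deriv0; under eq_fun do rewrite horner0.
  under [X in _ /\ is_derive _ _ X _]eq_fun do rewrite horner0.
  rewrite horner0 mulr0/= oppr0.
  by split; apply: is_derive_cst.
have ReE s : complex.Re (p * 'X + c%:P).[circle s] =
   complex.Re p.[circle s] * cos s - complex.Im p.[circle s] * sin s + complex.Re c.
  by rewrite !hornerE; case: (p.[_]) => x y; case: c.
have ImE s : complex.Im (p * 'X + c%:P).[circle s] =
   complex.Re p.[circle s] * sin s + complex.Im p.[circle s] * cos s + complex.Im c.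
  by rewrite !hornerE; case: (p.[_]) => x y; case: c {ReE}.
under eq_fun do rewrite ReE.
under [X in _ /\ is_derive _ _ X _]eq_fun do rewrite ImE.
rewrite derivD derivC addr0 derivM derivX mulr1 !hornerE.
split; apply: is_derive_eq; rewrite /GRing.scale/=;
  case: (p.[_]) => x y /=; case: (p^`().[_]) => u v /=; ring.
Qed.

Lemma continuous_Re_horner_circle p :
  continuous (fun t => complex.Re p.[circle t]).
Proof.
move=> t; apply: differentiable_continuous; apply/derivable1_diffP.
by have [[]] := is_derive_horner_circle p t.
Qed.

Lemma continuous_Im_horner_circle p :
  continuous (fun t => complex.Im p.[circle t]).
Proof.
move=> t; apply: differentiable_continuous; apply/derivable1_diffP.
by have [_ []] := is_derive_horner_circle p t.
Qed.

Lemma cmod_Re_Im (z : R[i]) :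
  cmod z = Num.sqrt (complex.Re z ^+ 2 + complex.Im z ^+ 2).
Proof. by case: z. Qed.

Lemma cmod_sqr (z : R[i]) :
  cmod z ^+ 2 = complex.Re z ^+ 2 + complex.Im z ^+ 2.
Proof. by rewrite cmod_Re_Im sqr_sqrtr// addr_ge0 ?sqr_ge0. Qed.

Lemma continuous_cmod_horner_circle p :
  continuous (fun t => cmod p.[circle t]).
Proof.
rewrite (_ : (fun t => _) = fun t => Num.sqrt (complex.Re p.[circle t] *
  complex.Re p.[circle t] + complex.Im p.[circle t] * complex.Im p.[circle t])).
  move=> t; apply: continuous_comp; last exact: sqrt_continuous.
  by apply: cvgD; apply: cvgM;
    (exact: continuous_Re_horner_circle || exact: continuous_Im_horner_circle).
by apply/funext => t; rewrite cmod_Re_Im !expr2.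
Qed.

Definition circle_integral (F : R -> R) : R :=
  \int[mu]_(t in `[0%R, 2 * pi]) F t.

Lemma circle_integrable (F : R -> R) : continuous F ->
  mu.-integrable `[0, 2 * pi] (EFin \o F).
Proof.
move=> cF; apply: continuous_compact_integrable; first exact: segment_compact.
exact: continuous_subspaceT.
Qed.

Lemma pi2_gt0 : 0 < 2 * pi :> R.
Proof. by rewrite mulr_gt0// pi_gt0. Qed.

Lemma circle_integral_cst (c : R) : circle_integral (fun=> c) = 2 * pi * c.
Proof.
rewrite /circle_integral Rintegral_cst//= lebesgue_measure_itv/= lte_fin pi2_gt0.
by rewrite -EFinB subr0 mulrC.
Qed.

Lemma le_circle_integral (F G : R -> R) : continuous F -> continuous G ->
  (forall t, F t <= G t) -> circle_integral F <= circle_integral G.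
Proof.
by move=> cF cG FG; apply: le_Rintegral => //; exact: circle_integrable.
Qed.

Lemma circle_integralD (F G : R -> R) : continuous F -> continuous G ->
  circle_integral (fun t => F t + G t) = circle_integral F + circle_integral G.
Proof.
by move=> cF cG; apply: RintegralD => //; exact: circle_integrable.
Qed.

Lemma circle_integralZl (c : R) (F : R -> R) : continuous F ->
  circle_integral (fun t => c * F t) = c * circle_integral F.
Proof. by move=> cF; apply: RintegralZl => //; exact: circle_integrable. Qed.

Lemma exists_antiderivative p : exists q, q^`() = p.
Proof.
exists (\poly_(i < (size p).+1) (p`_i.-1 / i%:R)).
apply/polyP => i; rewrite coef_deriv coef_poly ltnS.
have [ip|pi_] := ltnP i (size p); last by rewrite mul0rn nth_default.
by rewrite -[LHS]mulr_natr divfK// pnatr_eq0.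
Qed.

(** If p = q', the integrand is the derivative of Im q(e^(it)), which takes the same value at 0 and
    at 2 pi. *)
Lemma circle_integral_ReM p :
  circle_integral (fun t => complex.Re (circle t * p.[circle t])) = 0.
Proof.
have [q <-] := exists_antiderivative p.
have cF : continuous (fun t => complex.Re (circle t * q^`().[circle t])).
  rewrite (_ : (fun t => _) = fun t => complex.Re (q^`() * 'X).[circle t]).
    exact: continuous_Re_horner_circle.
  by apply/funext => t; rewrite hornerMX mulrC.
rewrite /circle_integral /Rintegral.
rewrite (@continuous_FTC2 _ _ (fun t => complex.Im q.[circle t])).
- by rewrite circle2pi circle0 -EFinB subrr.
- exact: pi2_gt0.
- exact: continuous_subspaceT.
- split => [t _||].
  + by have [_ []] := is_derive_horner_circle q t.
  + by apply: cvg_at_right_filter; exact: continuous_Im_horner_circle.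
  + by apply: cvg_at_left_filter; exact: continuous_Im_horner_circle.
- move=> t _; rewrite derive1E; apply: derive_val.
  by have [] := is_derive_horner_circle q t.
Qed.

Lemma continuous_cmod2_horner_circle p :
  continuous (fun t => cmod p.[circle t] ^+ 2).
Proof.
rewrite (_ : (fun t => _) = fun t => cmod p.[circle t] * cmod p.[circle t]).
  by move=> t; apply: cvgM; exact: continuous_cmod_horner_circle.
by apply/funext => t; rewrite expr2.
Qed.

(** Induction on p: on the circle |z p + c|^2 = |c|^2 + |p|^2 + 2 Re (z conj(c) p), and the cross
    term has integral 0. Each step thus splits off one coefficient. *)
Lemma bessel_circle p n :
  2 * pi * \sum_(0 <= k < n) cmod p`_k ^+ 2 <=
  circle_integral (fun t => cmod p.[circle t] ^+ 2).
Proof.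
elim/poly_ind: p n => [|p c IHp] n.
  rewrite big1 => [|k _]; last by rewrite coef0 cmod0 expr0n.
  by rewrite mulr0 Rintegral_ge0// => t _; rewrite sqr_ge0.
case: n => [|n].
  by rewrite big_nil mulr0 Rintegral_ge0// => t _; rewrite sqr_ge0.
rewrite big_nat_recl//= coefD coefMX coefC/= add0r.
under eq_bigr do rewrite coefD coefMX coefC/= addr0.
have E t : cmod (p * 'X + c%:P).[circle t] ^+ 2 = cmod c ^+ 2 +
    (cmod p.[circle t] ^+ 2 + 2 * complex.Re (circle t * (c^* *: p).[circle t])).
  rewrite hornerD hornerM hornerX hornerC hornerZ !cmod_sqr.
  have : complex.Re (circle t) ^+ 2 + complex.Im (circle t) ^+ 2 = 1.
    by rewrite -cmod_sqr cmod_circle expr1n.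
  move: (circle t) (p.[_]) c => [x y] [u v] [c1 c2] /= xy1.
  transitivity (c1 ^+ 2 + c2 ^+ 2 + ((u ^+ 2 + v ^+ 2) * (x ^+ 2 + y ^+ 2) +
    2 * (x * (c1 * u - - c2 * v) - y * (c1 * v + - c2 * u)))); first by ring.
  by rewrite xy1 mulr1.
under [X in _ <= circle_integral X]eq_fun do rewrite E.
have cR : continuous (fun t => complex.Re (circle t * (c^* *: p).[circle t])).
  rewrite (_ : (fun t => _) = fun t => complex.Re ((c^* *: p) * 'X).[circle t]).
    exact: continuous_Re_horner_circle.
  by apply/funext => t; rewrite hornerMX mulrC.
have c2R : continuous (fun t => 2 * complex.Re (circle t * (c^* *: p).[circle t])).
  by move=> t; apply: cvgM; [exact: cvg_cst|exact: cR].
have cP := @continuous_cmod2_horner_circle p.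
rewrite circle_integralD; last 2 first.
- by move=> t; exact: cvg_cst.
- by move=> t; apply: cvgD; [exact: cP|exact: c2R].
rewrite (circle_integralD cP c2R) (circle_integralZl _ cR).
rewrite circle_integral_ReM mulr0 addr0.
by rewrite circle_integral_cst mulrDr lerD2l.
Qed.

Lemma hardy_inequality_poly p n :
  2 * pi * \sum_(0 <= k < n) cmod p`_k / k.+1%:R <=
  8 * circle_integral (fun t => cmod p.[circle t]).
Proof.
set J := circle_integral _.
apply/ler_addgt0Pl => e e0.
(* The errors add up to 2 pi (8 + n) d: at most d for each of the n coefficients, and 2 pi d in each
   of the two Bessel bounds, multiplied by 4. *)
pose K : R := 2 * pi * (8 + n%:R); have K0 : 0 < K.
  by rewrite mulr_gt0 ?pi2_gt0// ltr_wpDr.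
pose d := e / K; have d0 : 0 < d by rewrite divr_gt0.
have [g [h H]] := balanced_factorization_poly p d0.
have cp := @continuous_cmod_horner_circle p.
have cpd : continuous (fun t => cmod p.[circle t] + d).
  by move=> t; apply: cvgD; [exact: cp|exact: cvg_cst].
have Jd : circle_integral (fun t => cmod p.[circle t] + d) = J + 2 * pi * d.
  rewrite circle_integralD ?circle_integral_cst//.
  by move=> t; exact: cvg_cst.
have l2 q : (forall t, cmod q.[circle t] ^+ 2 <= cmod p.[circle t] + d) ->
    2 * pi * \sum_(0 <= k < n) cmod q`_k ^+ 2 <= J + 2 * pi * d.
  move=> qp; rewrite (le_trans (bessel_circle q n))// -Jd.
  by apply: le_circle_integral => //; exact: continuous_cmod2_horner_circle.
have lg := l2 g (fun t => let: And3 _ X _ := H _ (cmod_circle t) in X).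
have lh := l2 h (fun t => let: And3 _ _ X := H _ (cmod_circle t) in X).
(* Bessel's inequality bounds each coefficient by the maximum modulus on the circle. *)
have err k : cmod (g * h - p)`_k <= d.
  rewrite -(@ler_pXn2r _ 2) ?nnegrE ?cmod_ge0// ?(ltW d0)//.
  rewrite -(ler_pM2l pi2_gt0).
  apply: (@le_trans _ _ (2 * pi * \sum_(0 <= j < k.+1) cmod (g * h - p)`_j ^+ 2)).
    rewrite ler_pM2l ?pi2_gt0// big_nat_recr//= lerDr sumr_ge0// => j _.
    by rewrite sqr_ge0.
  rewrite (le_trans (bessel_circle _ _))// -circle_integral_cst.
  apply: le_circle_integral => [||t].
  - exact: continuous_cmod2_horner_circle.
  - by move=> t; exact: cvg_cst.
  - have [ghp _ _] := H _ (cmod_circle t).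
    by rewrite !hornerE lerXn2r ?nnegrE ?cmod_ge0// ltW.
(* The coefficients of g h are Cauchy products, so the sum runs over the triangle i + j < n, part of
   the square in Hilbert's inequality. *)
have gh : \sum_(0 <= k < n) cmod (g * h)`_k / k.+1%:R <=
   4 * (\sum_(0 <= i < n) cmod g`_i ^+ 2 + \sum_(0 <= i < n) cmod h`_i ^+ 2).
  rewrite (le_trans _ (hilbert_inequality (fun i => cmod g`_i) (fun i => cmod h`_i) n))//.
  pose F i j := cmod g`_i * cmod h`_j / (i + j).+1%:R.
  have F0 i j : 0 <= F i j by rewrite !mulr_ge0 ?cmod_ge0.
  rewrite (@le_trans _ _ (\sum_(0 <= k < n) \sum_(0 <= i < k.+1) F i (k - i)%N))//.
    apply: ler_sum_nat => k _.
    rewrite coefM (eq_big_nat _ _ (F2 := fun i => cmod g`_i * cmod h`_(k - i)%N / k.+1%:R)).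
      rewrite -mulr_suml ler_pM2r ?invr_gt0// big_mkord (le_trans (cmod_sum _ _ _))//.
      by apply: ler_sum => i _; rewrite cmodM.
    by move=> i /andP[_ ik]; rewrite /F subnKC.
  rewrite sum_antidiagonal; apply: ler_sum_nat => i _.
  rewrite [leRHS](@big_cat_nat _ _ _ (n - i)%N 0 n)//= ?leq_subr//.
  by rewrite lerDl sumr_ge0// => j _; exact: F0.
have -> : e + 8 * J = 2 * pi * (n%:R * d) + 8 * (J + 2 * pi * d).
  have -> : e = 2 * pi * (8 + n%:R) * d by rewrite /d /K mulrC divfK// gt_eqF.
  by ring.
rewrite (@le_trans _ _ (2 * pi * (n%:R * d +
    \sum_(0 <= k < n) cmod (g * h)`_k / k.+1%:R)))//.
  rewrite ler_pM2l ?pi2_gt0//.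
  have -> : n%:R * d = \sum_(0 <= k < n) d by rewrite sumr_const_nat subn0 mulr_natl.
  rewrite -big_split ler_sum// => k _ /=.
  rewrite (@le_trans _ _ ((d + cmod (g * h)`_k) / k.+1%:R))//.
    rewrite ler_pM2r ?invr_gt0//.
    have := cmod_addr_sub p`_k (g * h)`_k; rewrite cmod_dist -coefB.
    by have := err k; lra.
  rewrite mulrDl lerD2r ler_pdivrMr// -[leLHS]mulr1 ler_pM2l//.
  by rewrite ler1n.
rewrite mulrDr lerD2l.
apply: (le_trans (ler_wpM2l (ltW pi2_gt0) gh)).
by move: lg lh; rewrite mulrCA mulrDr; lra.
Qed.

End CircleIntegrals.

(** The integral of a nonnegative function is a supremum over the simple functions below it, so
    comparing the two suprema covers arbitrary integrands, measurable or not. *)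
Lemma ge0_le_integralW d (T : measurableType d) (R : realType)
    (mu : {measure set T -> \bar R}) (D : set T) (f g : T -> \bar R) :
  (forall x, D x -> 0 <= f x)%E -> (forall x, D x -> f x <= g x)%E ->
  (\int[mu]_(x in D) f x <= \int[mu]_(x in D) g x)%E.
Proof.
move=> f0 fg; rewrite integral_mkcond [leRHS]integral_mkcond.
have fgD x : (patch (cst 0) D f x <= patch (cst 0) D g x)%E.
  by rewrite /patch; case: ifPn => // /set_mem; exact: fg.
have fD0 x : (0 <= patch (cst 0) D f x)%E.
  by rewrite /patch; case: ifPn => // /set_mem; exact: f0.
rewrite !ge0_integralTE//; last by move=> x; exact: le_trans (fgD x).
apply: le_ereal_sup => _ [h hf <-]; exists h => // x.
exact: le_trans (hf x) (fgD x).
Qed.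

(** * From polynomials to the Hardy space *)

Section HardyInequality.
Variable R : realType.
Implicit Types (a : nat -> R[i]^o) (f : R[i]^o -> R[i]^o).

Lemma hardy1_mean_bound f : hardy1 f ->
  exists M : R, forall r : R, 0 < r -> r < 1 -> (integral_mean1 f r <= M%:E)%E.
Proof.
move=> [_]; set s := ereal_sup _ => soo.
have ub r : 0 < r -> r < 1 -> (integral_mean1 f r <= s)%E.
  by move=> r0 r1; apply: ereal_sup_ubound; exists r => //=; rewrite in_itv/= r0.
have s0 : (0 <= s)%E.
  apply: (le_trans _ (ub (1 / 2) _ _)); [|lra|lra].
  rewrite mule_ge0// ?lee_fin ?invr_ge0 ?(ltW (pi2_gt0 R))//.
  by apply: integral_ge0 => t _; rewrite lee_fin cmod_ge0.
exists (fine s) => r r0 r1; rewrite fineK ?ub//.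
by rewrite fin_numElt soo (lt_le_trans _ s0).
Qed.

Lemma hardy_inequality_dilated f a (M r e : R) n : has_power_series f a ->
  (integral_mean1 f r <= M%:E)%E -> 0 < r -> r < 1 -> 0 < e ->
  \sum_(0 <= k < n) cmod (a k) * r ^+ k / k.+1%:R <= 8 * (M + e).
Proof.
move=> fa fM r0 r1 e0.
have [N HN] := power_series_uniform fa (ltW r0) r1 e0.
(* The choice m >= n keeps the first n coefficients of the dilated series, and m >= N keeps p within
   e of f on the circle of radius r. *)
pose m := maxn N n; pose p : {poly R[i]} := \poly_(k < m) (a k * r%:C ^+ k).
pose z t : R[i] := (r * cos t) +i* (r * sin t).
have zE t : z t = r%:C * circle t.
  by apply/eqP; rewrite eq_complex /= !mul0r subr0 addr0 !eqxx.
have pE t : p.[circle t] = \sum_(0 <= k < m) a k * z t ^+ k.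
  rewrite horner_poly big_mkord; apply: eq_bigr => k _.
  by rewrite zE exprMn mulrA.
have pf t : cmod p.[circle t] - e <= cmod (f (z t)).
  have zr : cmod (z t) <= r.
    by rewrite zE cmodM cmod_circle mulr1 cmod_real gtr0_norm.
  have := HN m (leq_maxl _ _) _ zr; rewrite -pE cmod_dist.
  have := cmod_addr_sub p.[circle t] (f (z t)); lra.
(* G is continuous and lies between 0 and |f(r e^(it))|, so its integral is controlled by the mean
   of f, while |p| <= G + e. *)
pose G t := Num.max 0 (cmod p.[circle t] - e).
have cp := @continuous_cmod_horner_circle _ p.
have cG : continuous G.
  move=> t; apply: (@continuous_max _ _ (cst 0) (fun t => cmod p.[circle t] - e)).
    exact: cvg_cst.
  by apply: cvgB; [exact: cp|exact: cvg_cst].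
have GM : circle_integral G <= 2 * pi * M.
  have intG : ((circle_integral G)%:E =
      \int[@lebesgue_measure R]_(t in `[0%R, (2 * pi)%R]) (G t)%:E)%E.
    rewrite /circle_integral /Rintegral fineK//.
    exact: (integrable_fin_num _ (circle_integrable cG)).
  rewrite -ler_pdivrMl ?pi2_gt0// -lee_fin EFinM intG.
  apply: le_trans fM; rewrite lee_wpmul2l// ?lee_fin ?invr_ge0 ?(ltW (pi2_gt0 R))//.
  apply: ge0_le_integralW => t _; rewrite lee_fin; first by rewrite le_max lexx.
  by rewrite ge_max cmod_ge0 pf.
have JG : circle_integral (fun t => cmod p.[circle t]) <= 2 * pi * (M + e).
  rewrite mulrDr -(circle_integral_cst e).
  apply: (@le_trans _ _ (circle_integral (fun t => G t + e))).
    apply: le_circle_integral => //.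
      by move=> t; apply: cvgD; [exact: cG|exact: cvg_cst].
    by move=> t; rewrite -lerBlDr le_max lexx orbT.
  rewrite circle_integralD ?lerD//.
  by move=> t; exact: cvg_cst.
have H := hardy_inequality_poly p n; rewrite -(ler_pM2l (pi2_gt0 R)).
apply: (le_trans (le_trans _ H)); last by rewrite mulrCA ler_pM2l.
rewrite ler_pM2l ?pi2_gt0//; apply: ler_sum_nat => k /andP[_ kn].
rewrite coef_poly (leq_trans kn) ?leq_maxr// cmodM cmodX cmod_real gtr0_norm//.
Qed.

Lemma le_sum_of_dilations (x : nat -> R) (B : R) n : (forall k, 0 <= x k) ->
  (forall r, 0 < r -> r < 1 -> \sum_(0 <= k < n) x k * r ^+ k <= B) ->
  \sum_(0 <= k < n) x k <= B.
Proof.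
move=> x0 H; set S := \sum_(0 <= k < n) x k.
have S0 : 0 <= S by rewrite sumr_ge0.
have bernoulli (d : R) m : 0 < d -> d < 1 -> 1 - m%:R * d <= (1 - d) ^+ m.
  move=> d0 d1; elim: m => [|m IHm]; first by rewrite mul0r subr0 expr0.
  rewrite exprSr (le_trans _ (ler_wpM2r _ IHm)) ?subr_ge0 ?(ltW d1)//.
  rewrite -natr1; have : 0 <= m%:R :> R by []; nra.
apply/ler_addgt0Pr => e e0.
(* With r = 1 - d, Bernoulli's inequality gives r^k >= 1 - n d for k < n, so S exceeds B by at most
   n d S <= d K <= e. *)
pose K := n%:R * S + 1; have K0 : 0 < K by rewrite ltr_wpDl ?mulr_ge0.
pose d := Num.min (1 / 2) (e / K).
have d0 : 0 < d by rewrite lt_min divr_gt0//= divr_gt0.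
have d1 : d < 1 by rewrite (le_lt_trans (_ : _ <= 1 / 2)) ?ge_min ?lexx//; lra.
have dK : d * K <= e by rewrite -ler_pdivlMr// ge_min lexx orbT.
have := H (1 - d); rewrite subr_gt0 => /(_ d1) /(_ ltac:(lra)) HB.
have : (1 - n%:R * d) * S <= B.
  apply: le_trans HB; rewrite mulr_sumr; apply: ler_sum_nat => k /andP[_ kn].
  rewrite mulrC ler_wpM2l// (le_trans (bernoulli _ _ d0 d1))//.
  by rewrite ler_wiXn2l ?subr_ge0 ?(ltW d1)// ?gerBl ?(ltW d0)// ltnW.
move: dK; rewrite /K; lra.
Qed.

Lemma hardy_inequality f a : hardy1 f -> has_power_series f a ->
  exists B : R, forall n, \sum_(0 <= k < n) cmod (a k) / k.+1%:R <= B.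
Proof.
move=> f1 fa; have [M HM] := hardy1_mean_bound f1.
exists (8 * M) => n; apply: le_sum_of_dilations => [k|r r0 r1].
  by rewrite divr_ge0 ?cmod_ge0.
apply/ler_addgt0Pl => e e0; have e80 : 0 < e / 8 by rewrite divr_gt0.
under eq_bigr do rewrite mulrAC.
rewrite (le_trans (hardy_inequality_dilated n fa (HM r r0 r1) r0 r1 e80))//.
lra.
Qed.

End HardyInequality.

(** * Dyadic layers and Carleson measures *)

Section DyadicSums.
Variable R : realType.
Local Notation h i := ((2^-1 : R) ^+ i).

Lemma half_exp_gt0 i : 0 < h i. Proof. by rewrite exprn_gt0// invr_gt0. Qed.

Lemma half_exp_ge0 i : 0 <= h i. Proof. exact/ltW/half_exp_gt0. Qed.

Lemma half_exp_le1 i : h i <= 1.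
Proof. by rewrite exprn_ile1// invf_le1// ler1n. Qed.

Lemma half_exp_le i j : (i <= j)%N -> h j <= h i.
Proof. by move=> ij; rewrite ler_wiXn2l// invf_le1// ler1n. Qed.

Lemma half_expS i : h i.+1 = h i / 2.
Proof. by rewrite exprSr. Qed.

(** A Riemann sum for the integral of t^n. For a = 1 - 2^-(i+1) and b = 1 - 2^-(i+2) one has (b - a)
    a^n <= (b^(n+1) - a^(n+1)) / (n+1), which telescopes; the 4 comes from b - a = 2^-i / 4. *)
Lemma sum_dyadic_pow n m :
  \sum_(0 <= i < m) h i * (1 - h i.+1) ^+ n <= 4 / n.+1%:R.
Proof.
have step i : h i * (1 - h i.+1) ^+ n <=
    4 / n.+1%:R * ((1 - h i.+2) ^+ n.+1 - (1 - h i.+1) ^+ n.+1).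
  have a0 : 0 <= 1 - h i.+1 by rewrite subr_ge0 half_exp_le1.
  have ab : 1 - h i.+1 <= 1 - h i.+2 by rewrite lerB// half_exp_le.
  have hE : h i = 4 * ((1 - h i.+2) - (1 - h i.+1)).
    by rewrite (half_expS i.+1) (half_expS i); lra.
  rewrite hE subrXX; move: (1 - h i.+1) (1 - h i.+2) a0 ab => a b a0 ab.
  rewrite -!mulrA ler_pM2l// [leRHS]mulrCA ler_wpM2l ?subr_ge0//.
  rewrite ler_pdivlMl ?ltr0n//.
  have -> : n.+1%:R * a ^+ n = \sum_(j < n.+1) a ^+ n.
    by rewrite sumr_const card_ord mulr_natl.
  apply: ler_sum => j _ /=.
  have -> : a ^+ n = a ^+ (n - j) * a ^+ j by rewrite -exprD subnK// -ltnS.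
  by rewrite ler_wpM2r ?exprn_ge0// lerXn2r ?nnegrE// (le_trans a0).
have tele : \sum_(0 <= i < m) ((1 - h i.+2) ^+ n.+1 - (1 - h i.+1) ^+ n.+1) <= 1.
  rewrite (telescope_sumr (fun i => (1 - h i.+1) ^+ n.+1))//.
  have u k : 0 <= 1 - h k /\ 1 - h k <= 1.
    by rewrite subr_ge0 half_exp_le1 gerBl half_exp_ge0.
  have [u0 u1] := u m.+1; have [v0 v1] := u 1%N.
  rewrite (@le_trans _ _ ((1 - h m.+1) ^+ n.+1))//; last exact: exprn_ile1.
  by rewrite gerBl exprn_ge0.
rewrite (le_trans (ler_sum _ (fun i _ => step i)))// -mulr_sumr.
by rewrite -[leRHS]mulr1 ler_wpM2l// divr_ge0.
Qed.

Lemma sum_powR_le (b : R) i : 0 < b -> b < 1 ->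
  \sum_(0 <= j < i) j.+1%:R `^ (b - 1) <= 2 / b * i%:R `^ b.
Proof.
move=> b0 b1; elim: i => [|i IHi].
  by rewrite big_nil mulr_ge0 ?divr_ge0 ?powR_ge0// ltW.
rewrite big_nat_recr//= (le_trans (lerD IHi (lexx _)))//.
have i0 : 0 < i.+1%:R :> R by rewrite ltr0n.
have i1 : 1 <= i.+1%:R :> R by rewrite ler1n.
have -> : i.+1%:R `^ (b - 1) = i.+1%:R `^ b / i.+1%:R :> R.
  rewrite powRD ?powRN ?powRr1 ?(ltW i0)//.
  by apply/implyP => _; rewrite gt_eqF.
have P0 : 0 <= i.+1%:R `^ b :> R by rewrite powR_ge0.
have y0 : 0 < b / i.+1%:R by rewrite divr_gt0.
have y1 : b / i.+1%:R <= 1 by rewrite ler_pdivrMr// mul1r (le_trans (ltW b1)).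
(* This makes the increment of the right side at least the new term. With y = b / (i+1) it follows
   from ln (1 - x) <= - x and exp (- y) <= 1 / (1 + y) <= 1 - y / 2 for 0 < y <= 1; the case i = 0
   is separate because of the logarithm. *)
have key : i%:R `^ b <= i.+1%:R `^ b * (1 - b / i.+1%:R / 2) :> R.
  have [->|ipos] := posnP i.
    rewrite powR0 ?gt_eqF// mulr_ge0// subr_ge0; lra.
  have ir0 : 0 < i%:R :> R by rewrite ltr0n.
  have -> : i%:R = i.+1%:R * (i%:R / i.+1%:R) :> R.
    by rewrite mulrC divfK// gt_eqF.
  have q0 : 0 < i%:R / i.+1%:R :> R by rewrite divr_gt0.
  rewrite powRM ?(ltW i0) ?(ltW q0)// ler_wpM2l// /powR gt_eqF//.
  have lnq : ln (i%:R / i.+1%:R) <= - i.+1%:R^-1 :> R.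
    have -> : i%:R / i.+1%:R = 1 + - i.+1%:R^-1 :> R.
      have {1}-> : i%:R = i.+1%:R - 1 :> R by rewrite -natr1 addrK.
      by rewrite mulrBl divff ?gt_eqF// mul1r.
    by rewrite le_ln1Dx// ltrN2 invf_lt1 ?ltr1n.
  rewrite (@le_trans _ _ (expR (- (b / i.+1%:R))))//.
    by rewrite ler_expR -mulrN ler_pM2l.
  rewrite expRN; move: (b / i.+1%:R) y0 y1 => y y0 y1.
  rewrite (@le_trans _ _ (1 + y)^-1)//.
    by rewrite lef_pV2 ?posrE ?expR_gt0 ?expR_ge1Dx//; lra.
  rewrite -[leLHS]mul1r ler_pdivrMr; last lra.
  nra.
apply: (le_trans (lerD (ler_wpM2l _ key) (lexx _))).
  by rewrite divr_ge0// ltW.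
rewrite le_eqVlt; apply/orP; left; apply/eqP.
by field; rewrite !gt_eqF.
Qed.

End DyadicSums.

Lemma nneseries_le (R : realType) (u : nat -> R) (B : R) :
  (forall i, 0 <= u i) -> (forall n, \sum_(0 <= i < n) u i <= B) ->
  (\sum_(i <oo) (u i)%:E <= B%:E)%E.
Proof.
move=> u0 uB; apply: lime_le.
  by apply: is_cvg_nneseries => i _ _; rewrite lee_fin.
by apply: nearW => n; rewrite sumEFin lee_fin.
Qed.

(** * Layers of the measure and their masses *)

Section DyadicLayers.
Variable R : realType.
Variable mu : {finite_measure set (measurableTypeR R) -> \bar R}.
Local Notation h i := ((2^-1 : R) ^+ i).

Definition dyadic_layer (i : nat) : set (measurableTypeR R) :=
  `[1 - h i, 1 - h i.+1[%classic.

Definition layer_mass (i : nat) : R := fine (mu (dyadic_layer i)).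

Lemma measurable_dyadic_layer i : measurable (dyadic_layer i).
Proof. exact: measurable_itv. Qed.

Lemma layer_massE i : mu (dyadic_layer i) = (layer_mass i)%:E.
Proof. by rewrite fineK// fin_num_measure//; exact: measurable_dyadic_layer. Qed.

Lemma layer_mass_ge0 i : 0 <= layer_mass i.
Proof. by rewrite fine_ge0. Qed.

Lemma bigcup_dyadic_layer : \bigcup_i dyadic_layer i = `[0, 1[%classic.
Proof.
apply/seteqP; split => t /=.
  move=> [i _]; rewrite /dyadic_layer /= !in_itv/= => /andP[t0 t1].
  rewrite (le_trans _ t0) ?subr_ge0 ?half_exp_le1//=.
  by rewrite (lt_le_trans t1)// gerBl half_exp_ge0.
rewrite in_itv/= => /andP[t0 t1].
have [n hn] : exists n, h n < 1 - t.
  have t1' : 0 < 1 - t by rewrite subr_gt0.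
  have : (fun n => h n) @ \oo --> (0 : R).
    by apply: cvg_expr; rewrite gtr0_norm ?invr_gt0// invf_lt1// ltr1n.
  move=> /cvgrPdist_lt /(_ _ t1') [n _ /(_ n (leqnn n))] /=.
  by rewrite sub0r normrN ger0_norm ?half_exp_ge0// => ?; exists n.
(* The least n with 2^-n < 1 - t is positive because t >= 0, and t lies in the layer of index n -
   1. *)
case: (ex_minnP (ex_intro (fun n => h n < 1 - t) n hn)) => -[|m] hm mmin.
  by move: hm; rewrite expr0; lra.
exists m => //; rewrite /dyadic_layer /= in_itv/=; apply/andP; split; last lra.
have : ~~ (h m < 1 - t) by apply/negP => /mmin; rewrite ltnn.
by rewrite -leNgt => ?; lra.
Qed.

Lemma trivIset_dyadic_layer : trivIset setT dyadic_layer.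
Proof.
apply: ltn_trivIset => n m mn; apply/seteqP; split => // t [].
rewrite /dyadic_layer /= !in_itv/= => /andP[_ tn] /andP[tm _].
by have hmn := half_exp_le R mn; exfalso; lra.
Qed.

Lemma dyadic_integral_le (F : measurableTypeR R -> R) (k : nat -> R) :
  measurable_fun (`[0, 1[%classic : set (measurableTypeR R)) F ->
  (forall t, 0 <= t < 1 -> 0 <= F t) ->
  (forall i t, dyadic_layer i t -> F t <= k i) ->
  (\int[mu]_(t in `[0%R, 1%R[) (F t)%:E <=
   \sum_(i <oo) (k i * layer_mass i)%:E)%E.
Proof.
move=> mF F0 Fk; rewrite -bigcup_dyadic_layer ge0_integral_bigcup//; last 4 first.
- exact: measurable_dyadic_layer.
- by rewrite bigcup_dyadic_layer; exact/measurable_EFinP.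
- by move=> t; rewrite bigcup_dyadic_layer /= in_itv/= lee_fin; exact: F0.
- exact: trivIset_dyadic_layer.
apply: lee_nneseries => i _.
  move=> _; apply: integral_ge0 => t It; rewrite lee_fin; apply: F0.
  have : (\bigcup_i dyadic_layer i) t by exists i.
  by rewrite bigcup_dyadic_layer /= in_itv.
rewrite EFinM -layer_massE -integral_cst; last exact: measurable_dyadic_layer.
apply: ge0_le_integralW => t It; rewrite lee_fin; last exact: Fk.
apply: F0; have : (\bigcup_i dyadic_layer i) t by exists i.
by rewrite bigcup_dyadic_layer /= in_itv.
Qed.

(** At t = 1 - 2^-i the logarithm is i ln 2, which for i >= 1 is at least (i+1) (ln 2) / 2; the
    constant [K] records this loss. *)
Lemma carleson_layer_mass (alpha : R) : 0 < alpha -> log_carleson alpha 1 mu ->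
  exists2 C : R, 0 < C &
    forall i, layer_mass i * i.+1%:R `^ alpha <= C * h i.
Proof.
move=> a0 [C0 C00 HC].
have ln2 : 0 < ln 2 :> R by rewrite ln_gt0// ltr1n.
pose K : R := (ln 2 / 2) `^ alpha.
have K0 : 0 < K by rewrite powR_gt0// divr_gt0.
pose M := fine (mu setT); have M0 : 0 <= M by rewrite fine_ge0.
exists (M + C0 / K) => [|i]; first by rewrite ltr_wpDl// divr_gt0.
(* In layer 0 the logarithm vanishes at the left endpoint, so the total mass of mu is used
   instead. *)
have [->|i0] := posnP i.
  rewrite powR1 mulr1 expr0 mulr1 ler_wpDr//.
    by rewrite divr_ge0// ltW.
  rewrite -lee_fin -layer_massE.
  rewrite /M fineK ?fin_num_measure// le_measure ?inE//.
  exact: measurable_dyadic_layer.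
have t01 : 0 <= 1 - h i < 1.
  by rewrite subr_ge0 half_exp_le1 gtrBl half_exp_gt0.
have := HC _ t01; rewrite subKr div1r powRr1 ?half_exp_ge0//.
rewrite -exprVn invrK lnXn// => HCi.
have mi : (mu (dyadic_layer i) <= mu `[(1 - h i)%R, 1%R[%classic)%E.
  apply: le_measure; rewrite ?inE; [exact: measurable_dyadic_layer|exact: measurable_itv|].
  move=> t; rewrite /dyadic_layer/= !in_itv/= => /andP[-> t1] /=.
  by rewrite (lt_le_trans t1)// gerBl half_exp_ge0.
have : layer_mass i * (ln 2 *+ i) `^ alpha <= C0 * h i.
  rewrite -lee_fin EFinM -layer_massE (le_trans _ HCi)//.
  by rewrite lee_wpmul2r// lee_fin powR_ge0.
have lnle : i.+1%:R `^ alpha * K <= (ln 2 *+ i) `^ alpha.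
  have ln20 : 0 <= ln 2 / 2 :> R by rewrite divr_ge0// ltW.
  have A1 : 0 <= i.+1%:R * (ln 2 / 2) :> R by rewrite mulr_ge0.
  have A2 : 0 <= ln 2 *+ i :> R by rewrite mulrn_wge0// ltW.
  have A3 : i.+1%:R * (ln 2 / 2) <= ln 2 *+ i :> R.
    rewrite -[leRHS]mulr_natl -natr1.
    have i1 : 1 <= i%:R :> R by rewrite ler1n.
    nra.
  by rewrite -powRM// ge0_ler_powR ?nnegrE// ltW.
move=> H; rewrite mulrDl ler_wpDl//.
  by rewrite mulr_ge0 ?half_exp_ge0.
rewrite mulrAC ler_pdivlMr// (le_trans _ H)// -mulrA.
by rewrite ler_wpM2l// layer_mass_ge0.
Qed.

Lemma moment_ge0 n : 0 <= moment mu n.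
Proof.
rewrite /moment; apply: Rintegral_ge0 => t /=; rewrite in_itv/= => /andP[t0 _].
by rewrite exprn_ge0.
Qed.

(** On layer i the power t^n is at most (1 - 2^-(i+1))^n, which leaves the sum of
    [sum_dyadic_pow]. *)
Lemma moment_le (C : R) : 0 < C -> (forall i, layer_mass i <= C * h i) ->
  forall n, moment mu n <= 4 * C / n.+1%:R.
Proof.
move=> C0 HC n; rewrite /moment /Rintegral.
have H : (\int[mu]_(t in `[0%R, 1%R[) (t ^+ n)%:E <= (4 * C / n.+1%:R)%:E)%E.
  apply: (le_trans (@dyadic_integral_le (fun t => t ^+ n)
      (fun i => (1 - h i.+1) ^+ n) _ _ _)).
  - by apply: measurable_funX; exact: measurable_id.
  - by move=> t /andP[t0 _]; rewrite exprn_ge0.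
  - move=> i t; rewrite /dyadic_layer/= in_itv/= => /andP[t0 /ltW t1].
    have t0' : 0 <= t by rewrite (le_trans _ t0)// subr_ge0 half_exp_le1.
    by rewrite lerXn2r ?nnegrE// (le_trans t0').
  have r0 i : 0 <= 1 - h i by rewrite subr_ge0 half_exp_le1.
  apply: nneseries_le => [i|m]; first by rewrite mulr_ge0 ?layer_mass_ge0 ?exprn_ge0.
  rewrite (@le_trans _ _ (C * \sum_(0 <= i < m) h i * (1 - h i.+1) ^+ n))//.
    rewrite mulr_sumr; apply: ler_sum => i _.
    by rewrite mulrA [leRHS]mulrC ler_wpM2l// exprn_ge0.
  by rewrite [4 * C]mulrC -mulrA ler_pM2l// sum_dyadic_pow.
rewrite -lee_fin fineK// fin_numElt (le_lt_trans H) ?ltry// andbT.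
rewrite (lt_le_trans (ltNyr 0))//; apply: integral_ge0 => t /=.
by rewrite in_itv/= => /andP[t0 _]; rewrite lee_fin exprn_ge0.
Qed.

End DyadicLayers.

(** * Derivative of a power series *)

Section PowerSeriesDerivative.
Variable R : realType.
Implicit Types (c : nat -> R[i]^o) (z : R[i]^o).

(** Of the two factors in r^k = s^k s^k, one bounds the power of k+1, at the price of 1 / s for the
    shifted index, and the other is summed. *)
Lemma sum_natX_geometric_bounded (m : nat) (r : R) : 0 < r -> r < 1 ->
  exists2 K : R, 0 < K & forall n, \sum_(0 <= k < n) k.+1%:R ^+ m * r ^+ k <= K.
Proof.
move=> r0 r1; pose s := Num.sqrt r.
have s0 : 0 < s by rewrite sqrtr_gt0.
have s1 : s < 1 by rewrite -sqrtr1 ltr_sqrt.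
have s1' : 0 < 1 - s by rewrite subr_gt0.
have [B B0 HB] := natX_geometric_bounded m (ltW s0) s1.
exists (B / s / (1 - s)) => [|n]; first by rewrite !divr_gt0.
rewrite (@le_trans _ _ (\sum_(0 <= k < n) B / s * s ^+ k))//.
  apply: ler_sum => k _.
  have -> : r ^+ k = s ^+ k * s ^+ k by rewrite -exprMn -expr2 sqr_sqrtr// ltW.
  rewrite mulrA ler_wpM2r ?exprn_ge0 ?(ltW s0)// ler_pdivlMr// -mulrA -exprSr.
  exact: HB.
rewrite -mulr_sumr ler_wpM2l ?divr_ge0 ?(ltW B0) ?(ltW s0)//.
rewrite -[leRHS]mul1r ler_pdivlMr// big_mkord mulrC -opprB mulNr -subrX1 opprB.
by rewrite gerBl exprn_ge0// ltW.
Qed.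

(** The remainders satisfy e_(n+1) = (z + w) e_n + (n+1) z^n w^2, and (n+1)^2 + (n+1) <= (n+2)^2.
    The factor r on the left avoids the exponent n - 1. *)
Lemma expr_taylor1_remainder (z w : R[i]) (r : R) n :
  cmod z <= r -> cmod (z + w) <= r -> r <= 1 ->
  r * cmod ((z + w) ^+ n.+1 - z ^+ n.+1 - n.+1%:R * z ^+ n * w)
    <= cmod w ^+ 2 * (n.+1%:R ^+ 2 * r ^+ n).
Proof.
move=> zr zwr r1; have r0 : 0 <= r by rewrite (le_trans _ zr)// cmod_ge0.
elim: n => [|n IHn].
  rewrite !expr1 expr0 (_ : _ - _ - _ = 0) ?cmod0; last by ring.
  by rewrite mulr0 !mulr_ge0 ?exprn_ge0 ?cmod_ge0.
set e := _ - _ in IHn.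
have -> : (z + w) ^+ n.+2 - z ^+ n.+2 - n.+2%:R * z ^+ n.+1 * w =
   (z + w) * e + n.+1%:R * z ^+ n * w ^+ 2.
  rewrite /e [(z + w) ^+ n.+2]exprS -[n.+2%:R]natr1 [z ^+ n.+2]exprS.
  by rewrite [z ^+ n.+1]exprS; ring.
have w2 : 0 <= cmod w ^+ 2 by rewrite sqr_ge0.
rewrite (le_trans (ler_wpM2l r0 (cmod_le_add _ _)))// mulrDr.
have H1 : r * cmod ((z + w) * e) <= cmod w ^+ 2 * (n.+1%:R ^+ 2 * r ^+ n.+1).
  rewrite cmodM mulrCA (le_trans (ler_pM _ _ zwr IHn))//.
  - by rewrite cmod_ge0.
  - by rewrite mulr_ge0 ?cmod_ge0.
  - by rewrite [r ^+ n.+1]exprS le_eqVlt; apply/orP; left; apply/eqP; ring.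
have H2 : r * cmod (n.+1%:R * z ^+ n * w ^+ 2) <=
    cmod w ^+ 2 * (n.+1%:R * r ^+ n.+1).
  have -> : cmod (n.+1%:R * z ^+ n * w ^+ 2) = n.+1%:R * cmod z ^+ n * cmod w ^+ 2.
    rewrite !cmodM !cmodX; congr (_ * _ * _).
    by rewrite -(rmorph_nat (real_complex R)) cmod_real ger0_norm.
  rewrite [leLHS]mulrA [leLHS]mulrC ler_wpM2l// mulrCA ler_wpM2l//.
  by rewrite exprS ler_wpM2l// lerXn2r ?nnegrE ?cmod_ge0.
apply: (le_trans (lerD H1 H2)); rewrite -mulrDr ler_wpM2l// -mulrDl.
rewrite ler_wpM2r ?exprn_ge0// -[n.+2%:R]natr1.
have : 0 <= n.+1%:R :> R by []; nra.
Qed.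

Lemma power_series_derivative (f : R[i]^o -> R[i]^o) c (B : R) z :
  has_power_series f c -> (forall n, cmod (c n) <= B) -> unit_disc z ->
  exists d : R[i]^o,
    [/\ series (fun n => n.+1%:R * c n.+1 * z ^+ n : R[i]^o) @ \oo --> d,
        derivable f z 1 & derive1 f z = d].
Proof.
move=> fc cB; rewrite unit_discE => z1.
have B0 : 0 <= B by rewrite (le_trans _ (cB 0%N))// cmod_ge0.
pose r := (1 + cmod z) / 2.
have z0 := cmod_ge0 z.
have r0 : 0 < r by rewrite /r; lra.
have r1 : r < 1 by rewrite /r; lra.
have zr : cmod z < r by rewrite /r; lra.
have [K1 K10 HK1] := sum_natX_geometric_bounded 1 r0 r1.
have [K2 K20 HK2] := sum_natX_geometric_bounded 2 r0 r1.
have [|d dl] := @abs_summable_cvg R (fun n => n.+1%:R * c n.+1 * z ^+ n) (B * K1).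
  move=> n; apply: (le_trans _ (ler_wpM2l B0 (HK1 n))).
  rewrite mulr_sumr; apply: ler_sum => k _.
  rewrite !cmodM cmod_natr cmodX expr1 mulrA [B * _]mulrC.
  rewrite ler_pM ?mulr_ge0 ?exprn_ge0 ?cmod_ge0//.
    by rewrite ler_wpM2l.
  by rewrite lerXn2r ?nnegrE ?cmod_ge0 ?(ltW r0)// ltW.
(* The quadratic estimate is proved for partial sums, uniformly in their length, and passes to the
   limit. *)
have bound w : cmod w < r - cmod z ->
    cmod (f (z + w) - f z - d * w) <= B * (K2 / r) * cmod w ^+ 2.
  move=> wr.
  have zwr : cmod (z + w) < r by rewrite (le_lt_trans (cmod_le_add _ _))// addrC -ltrBrDr.
  have zw1 : unit_disc (z + w : R[i]^o) by rewrite unit_discE (lt_trans zwr).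
  have /cvg_cmodP f1 := fc _ zw1; have /cvg_cmodP f0 := fc _ z1.
  have /cvg_cmodP f2 := dl.
  apply/ler_addgt0Pl => e e0; have e30 : 0 < e / 3 by rewrite divr_gt0.
  have [N1 H1] := f1 _ e30; have [N2 H2] := f0 _ e30; have [N3 H3] := f2 _ e30.
  (* The series of f are cut at N+1 and the derived series at N, since differentiation removes the
     constant term. *)
  pose N := maxn N1 (maxn N2 N3).
  have {}H1 : cmod (series (fun k => c k * (z + w) ^+ k) N.+1 - f (z + w)) <= e / 3.
    by rewrite H1// (leq_trans (leq_maxl _ _) (leqnSn _)).
  have {}H2 : cmod (series (fun k => c k * z ^+ k) N.+1 - f z) <= e / 3.
    by rewrite H2// (leq_trans _ (leqnSn _))// leq_max leq_maxl orbT.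
  have {}H3 : cmod (series (fun n => n.+1%:R * c n.+1 * z ^+ n) N - d) <= e / 3.
    by rewrite H3// !leq_max leqnn !orbT.
  move: H1 H2 H3; set S1 := series _ _; set S0 := series _ _; set S2 := series _ _.
  move=> H1 H2 H3.
  have main : cmod (S1 - S0 - S2 * w) <= B * (K2 / r) * cmod w ^+ 2.
    have -> : S1 - S0 - S2 * w = \sum_(0 <= n < N) c n.+1 *
        ((z + w) ^+ n.+1 - z ^+ n.+1 - n.+1%:R * z ^+ n * w).
      rewrite /S1 /S0 /S2 /series/= 2?big_nat_recl//= !expr0.
      rewrite opprD addrACA subrr add0r mulr_suml -!sumrB.
      by apply: eq_bigr => n _; ring.
    rewrite (le_trans (cmod_sum _ _ _))//.
    apply: (@le_trans _ _ (\sum_(0 <= n < N) B * (cmod w ^+ 2 / r * (n.+1%:R ^+ 2 * r ^+ n)))).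
      apply: ler_sum => n _; rewrite cmodM ler_pM ?cmod_ge0//.
      rewrite [leRHS]mulrAC ler_pdivlMr// [leLHS]mulrC.
      by apply: expr_taylor1_remainder; exact: ltW.
    rewrite -mulr_sumr -mulr_sumr.
    rewrite (_ : _ * cmod w ^+ 2 = B * (cmod w ^+ 2 / r * K2)); last by ring.
    rewrite ler_wpM2l// ler_wpM2l// divr_ge0 ?sqr_ge0//.
    exact: ltW.
  have -> : f (z + w) - f z - d * w = (S1 - S0 - S2 * w) -
      (S1 - f (z + w)) + (S0 - f z) + (S2 - d) * w by ring.
  have w1 : cmod w <= 1 by lra.
  have H4 : cmod ((S2 - d) * w) <= e / 3.
    by rewrite cmodM -[leRHS]mulr1 ler_pM ?cmod_ge0.
  rewrite (le_trans (cmod_le_add _ _))// (le_trans (lerD (cmod_le_add _ _) (lexx _)))//.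
  rewrite (le_trans (lerD (lerD (cmod_le_sub _ _) (lexx _)) (lexx _)))//.
  move: main; set X := B * _ * _; lra.
(* The added 1 keeps L positive when B = 0. *)
pose L := B * (K2 / r) + 1.
have L0 : 0 < L.
  by rewrite ltr_wpDl ?ltr01// mulr_ge0// divr_ge0// ltW.
have quot : (fun w : R[i]^o => w^-1 *: (f (w + z) - f z) : R[i]^o) @ (0 : R[i]^o)^' --> d.
  apply/cvgrPdist_le => -[e e'] /=; rewrite ltcE/= => /andP[/eqP -> e0].
  pose dl0 := Num.min (r - cmod z) (e / L).
  have dl00 : 0 < dl0 by rewrite lt_min subr_gt0 zr divr_gt0.
  have dl0C : 0 < dl0%:C :> R[i] by rewrite -(rmorph0 (real_complex R)) ltcR.
  near=> w.
  have w0 : w != 0 by near: w; exact: nbhs_dnbhs_neq.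
  have wd : cmod w < dl0.
    have : `|w| < dl0%:C by near: w; exact: dnbhs0_lt.
    by rewrite normc_cmod ltcR.
  have [wr wL] : cmod w < r - cmod z /\ cmod w < e / L.
    by move: wd; rewrite lt_min => /andP[].
  rewrite normc_cmod [e +i* 0]complexr0 lecR cmod_dist.
  have cw0 : 0 < cmod w by rewrite lt_neqAle cmod_ge0 eq_sym cmod_eq0 w0.
  have -> : w^-1 *: (f (w + z) - f z) - d = w^-1 * (f (z + w) - f z - d * w).
    by rewrite /GRing.scale/= [w + z]addrC [RHS]mulrBr [d * w]mulrC mulKf.
  rewrite cmodM cmodV mulrC ler_pdivrMr// (le_trans (bound _ wr))//.
  rewrite expr2 mulrA ler_pM2r// (le_trans (ler_wpM2r (ltW cw0) (_ : _ <= L)))//.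
    by rewrite lerDl.
  by rewrite mulrC -ler_pdivlMr// ltW.
exists d; split; first exact: dl.
- have E : (fun w : R[i]^o => w^-1 *: ((f \o shift z) (w *: (1 : R[i]^o)) - f z)) =
      (fun w : R[i]^o => w^-1 *: (f (w + z) - f z) : R[i]^o).
    by apply/funext => w; rewrite /= /GRing.scale/= mulr1.
  by rewrite /derivable E; apply/cvg_ex; exists d; exact: quot.
- exact: (cvg_lim (@norm_hausdorff _ _)).
Unshelve. all: by end_near.
Qed.

End PowerSeriesDerivative.

(** * The kernel on the disc *)

Section DiscKernel.
Variables (R : realType) (alpha : R).
Hypothesis alpha_lt1 : alpha < 1.
Local Notation h i := ((2^-1 : R) ^+ i).
Local Notation leb2 := (@lebesgue_measure R \x @lebesgue_measure R)%E.

(* On the disc, the weight divided by |1 - t z|^2 is controlled by the distance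
   from z to 1, so that squares shrinking to 1 replace polar coordinates. *)
Definition dyadic_square (j : nat) : set (measurableTypeR R * measurableTypeR R) :=
  `[1 - 2 * h j, 1 + 2 * h j]%classic `*` `[- (2 * h j), 2 * h j]%classic.

Definition layer_weight (i : nat) (p : measurableTypeR R * measurableTypeR R) : R :=
  \sum_(0 <= j < i.+1) j.+1%:R `^ (alpha - 1) * 4 ^+ j * \1_(dyadic_square j) p.

Lemma measurable_dyadic_square j : measurable (dyadic_square j).
Proof. by apply: measurableX; exact: measurable_itv. Qed.

Lemma layer_weight_ge0 i p : 0 <= layer_weight i p.
Proof. by rewrite sumr_ge0// => j _; rewrite !mulr_ge0 ?powR_ge0 ?exprn_ge0. Qed.

Lemma measurable_layer_weight i : measurable_fun setT (layer_weight i).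
Proof.
apply: measurable_sum => j; apply: measurable_funM; first exact: measurable_cst.
by apply: measurable_indic; exact: measurable_dyadic_square.
Qed.

Lemma dyadic_square_measure j : leb2 (dyadic_square j) = (16 / 4 ^+ j)%:E.
Proof.
have h0 := half_exp_gt0 R j.
rewrite product_measure1E; [|exact: measurable_itv|exact: measurable_itv].
rewrite /= !lebesgue_measure_itv /= !lte_fin.
have -> : 1 - 2 * h j < 1 + 2 * h j by lra.
have -> : - (2 * h j) < 2 * h j by lra.
rewrite -!EFinB -EFinM; congr EFin.
have -> : (4 : R) ^+ j = 2 ^+ j * 2 ^+ j by rewrite -exprMn -natrM.
rewrite exprVn; field.
by rewrite expf_neq0.
Qed.

Lemma integral_layer_weight i :
  (\int[leb2]_p (layer_weight i p)%:E)%E =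
  (16 * \sum_(0 <= j < i.+1) j.+1%:R `^ (alpha - 1))%:E.
Proof.
have c0 j : 0 <= j.+1%:R `^ (alpha - 1) * 4 ^+ j by rewrite mulr_ge0 ?powR_ge0 ?exprn_ge0.
have mI j : measurable_fun setT (fun p => (\1_(dyadic_square j) p : R)%:E).
  apply/measurable_EFinP; apply: measurable_indic.
  exact: measurable_dyadic_square.
under eq_integral do rewrite /layer_weight -sumEFin.
rewrite ge0_integral_sum//; last first.
  move=> j; apply/measurable_EFinP; apply: measurable_funM; first exact: measurable_cst.
  by apply: measurable_indic; exact: measurable_dyadic_square.
rewrite mulr_sumr -sumEFin; apply: eq_bigr => j _.
under eq_integral do rewrite EFinM.
rewrite ge0_integralZl//.
rewrite integral_indic//; last exact: measurable_dyadic_square.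
rewrite setIT; transitivity ((j.+1%:R `^ (alpha - 1) * 4 ^+ j)%:E *
    (16 / 4 ^+ j)%:E)%E.
  by congr (_ * _)%E; exact: dyadic_square_measure.
rewrite -EFinM; congr EFin.
by field; rewrite expf_neq0.
Qed.

Lemma layer_weight_ge i j p : (j <= i)%N -> dyadic_square j p ->
  j.+1%:R `^ (alpha - 1) * 4 ^+ j <= layer_weight i p.
Proof.
move=> ji Qp; have n0 k : 0 <= k.+1%:R `^ (alpha - 1) * 4 ^+ k * \1_(dyadic_square k) p.
  by rewrite !mulr_ge0 ?powR_ge0 ?exprn_ge0.
rewrite /layer_weight big_mkord (bigD1 (Ordinal (ji : (j < i.+1)%N)))//= indicE mem_set// mulr1.
by rewrite lerDl sumr_ge0.
Qed.

Lemma cmod_le_abs_add (x y : R) : cmod (x +i* y) <= `|x| + `|y|.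
Proof. exact: cmod_le_Re_Im. Qed.

(** The index j is taken so that the point lies in Q_j and either j = i or it lies outside Q_(j+1).
    The bound rests on |1 - t z| >= 1 - t in both cases. *)
Lemma exists_square_scale (i : nat) (x y t : R) : cmod (x +i* y) < 1 ->
  1 - h i <= t -> t < 1 - h i.+1 ->
  exists j, [/\ (j <= i)%N, dyadic_square j (x, y) &
    h j / 2 <= cmod (1 - t%:C * (x +i* y))].
Proof.
move=> z1 ti t1; set z := x +i* y.
have t0 : 0 <= t by rewrite (le_trans _ ti)// subr_ge0 half_exp_le1.
have t1' : t < 1 by rewrite (lt_le_trans t1)// gerBl half_exp_ge0.
have low : 1 - t <= cmod (1 - t%:C * z).
  have := cmod_addr_sub 1 (t%:C * z); rewrite cmod1 cmodM cmod_real ger0_norm//.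
  have : t * cmod z <= t * 1 by rewrite ler_wpM2l// ltW.
  lra.
have x1 : `|x| < 1 by rewrite (le_lt_trans _ z1)//; exact: (abs_Re_le_cmod z).
have y1 : `|y| < 1 by rewrite (le_lt_trans _ z1)//; exact: (Im_le_cmod z).
have Q0 : dyadic_square 0 (x, y).
  move: x1 y1; rewrite !ltr_norml => /andP[? ?] /andP[? ?].
  by split => /=; rewrite in_itv/= expr0; apply/andP; split; lra.
have [j [ji Qj Qnj]] : exists j, [/\ (j <= i)%N, dyadic_square j (x, y) &
    (j < i)%N -> ~ dyadic_square j.+1 (x, y)].
  have [all_Q|/existsNP[m0 /not_implyP[m0i nQ0]]] :=
    pselect (forall m, (m <= i)%N -> dyadic_square m (x, y)).
    by exists i; split => //; [exact: all_Q|rewrite ltnn].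
  have ex : exists m, (m <= i)%N && (\1_(dyadic_square m) (x, y) == 0 :> R).
    by exists m0; rewrite m0i indicE memNset// eqxx.
  case: (ex_minnP ex) => -[|m] /andP[mi]; first by rewrite indicE mem_set// oner_eq0.
  move=> Qm mmin; exists m; split; first exact: ltnW.
    apply: contrapT => nQ; have := mmin m; rewrite (ltnW mi) indicE memNset// eqxx.
    by move=> /(_ isT); rewrite ltnn.
  by move=> _ /mem_set Qm'; move: Qm; rewrite indicE Qm' oner_eq0.
exists j; split => //.
have hj0 := half_exp_gt0 R j.
move: ji; rewrite leq_eqVlt => /orP[/eqP ji|ji].
  by rewrite (le_trans _ low)// -half_expS ji; lra.
(* The square Q_(j+1) has half-side 2^-j, so leaving it means |1 - z| >= 2^-j. Then |1 - z| <= |1 -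
   t z| + (1 - t) <= 2 |1 - t z| concludes. *)
have big : h j <= cmod (1 - z).
  rewrite leNgt; apply/negP => small; apply: (Qnj ji).
  have H1 : `|0 - y| <= cmod (1 - z) := Im_le_cmod (1 - z).
  have H2 : `|1 - x| <= cmod (1 - z) := abs_Re_le_cmod (1 - z).
  move: (le_lt_trans H1 small) (le_lt_trans H2 small).
  rewrite !ltr_norml => /andP[? ?] /andP[? ?].
  by split => /=; rewrite in_itv/= half_expS; apply/andP; split; lra.
have : cmod (1 - z) <= cmod (1 - t%:C * z) + (1 - t).
  rewrite (_ : 1 - z = (1 - t%:C * z) - (1 - t)%:C * z); last first.
    by rewrite rmorphB rmorph1; ring.
  rewrite (le_trans (cmod_le_sub _ _))// lerD2l cmodM cmod_real.
  rewrite gtr0_norm ?subr_gt0//.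
  by rewrite -[leRHS]mulr1 ler_wpM2l ?subr_ge0 ?ltW.
lra.
Qed.

(** In Q_j one has 1 - |z| <= |1 - z| <= 4 / 2^j, so the logarithm is at least (j - 1) ln 2 as well
    as ln 2, hence at least (j+1) (ln 2) / 3. The negative exponent reverses the inequality. *)
Lemma log_weight_le (j : nat) (x y : R) : cmod (x +i* y) < 1 ->
  dyadic_square j (x, y) ->
  ln (2 / (1 - cmod (x +i* y))) `^ (alpha - 1) <=
  (ln 2 / 3) `^ (alpha - 1) * j.+1%:R `^ (alpha - 1).
Proof.
move=> z1 [/=]; rewrite !in_itv/= => /andP[xl xr] /andP[yl yr].
set z := x +i* y in z1 *.
have ln2 : 0 < ln 2 :> R by rewrite ln_gt0// ltr1n.
have d0 : 0 < 1 - cmod z by rewrite subr_gt0.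
have hj0 := half_exp_gt0 R j.
have zle : 1 - cmod z <= 4 * h j.
  have := cmod_addr_sub 1 z; rewrite cmod1.
  have -> : 1 - z = (1 - x) +i* (- y) by apply/eqP; rewrite eq_complex /= sub0r !eqxx.
  have := cmod_le_abs_add (1 - x) (- y).
  have : `|1 - x| <= 2 * h j by rewrite ler_norml; apply/andP; split; lra.
  have : `|- y| <= 2 * h j by rewrite ler_norml; apply/andP; split; lra.
  lra.
set L := ln (2 / (1 - cmod z)).
have L1 : ln 2 <= L.
  rewrite ler_ln ?posrE ?divr_gt0// ler_pdivlMr//.
  have := cmod_ge0 z; lra.
have L2 : (j%:R - 1) * ln 2 <= L.
  rewrite (@le_trans _ _ (ln (2 / (4 * h j))))//; last first.
    rewrite ler_ln ?posrE ?divr_gt0 ?mulr_gt0//.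
    by rewrite ler_pM2l// lef_pV2 ?posrE ?mulr_gt0.
  have -> : 2 / (4 * h j) = 2 ^+ j / 2 :> R.
    by rewrite exprVn; field; rewrite expf_neq0.
  rewrite ln_div ?posrE ?exprn_gt0// lnXn// -[ln 2 *+ j]mulr_natl.
  by rewrite mulrBl mul1r.
have L3 : j.+1%:R * (ln 2 / 3) <= L.
  by rewrite -natr1; lra.
have L0 : 0 < j.+1%:R * (ln 2 / 3) :> R by rewrite mulr_gt0// divr_gt0.
rewrite [leRHS]mulrC -powRM ?divr_ge0 ?(ltW ln2)//.
have -> : alpha - 1 = - (1 - alpha) by rewrite opprB.
rewrite !powRN lef_pV2 ?posrE ?powR_gt0 ?(lt_le_trans L0)//.
by rewrite ge0_ler_powR ?nnegrE ?subr_ge0 ?(ltW alpha_lt1) ?(ltW L0)// (le_trans (ltW L0)).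
Qed.

Lemma disc_kernel_le : exists2 C : R, 0 < C &
  forall (i : nat) (x y t : R), cmod (x +i* y) < 1 ->
    1 - h i <= t -> t < 1 - h i.+1 ->
    ln (2 / (1 - cmod (x +i* y))) `^ (alpha - 1) <=
    C * layer_weight i (x, y) * cmod (1 - t%:C * (x +i* y)) ^+ 2.
Proof.
have c0 : 0 < (ln 2 / 3) `^ (alpha - 1).
  by rewrite powR_gt0// divr_gt0// ln_gt0// ltr1n.
(* The 4 compensates 4^j (2^-j / 2)^2 = 1 / 4. *)
exists (4 * (ln 2 / 3) `^ (alpha - 1)) => [|i x y t z1 t0 t1]; first by rewrite mulr_gt0.
have [j [ji Qj low]] := exists_square_scale z1 t0 t1.
apply: (le_trans (log_weight_le z1 Qj)).
have hj0 := half_exp_gt0 R j.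
rewrite -mulrA [4 * _]mulrC -[leRHS]mulrA ler_pM2l//.
have A : j.+1%:R `^ (alpha - 1) * 4 ^+ j * (h j / 2) ^+ 2 <=
    layer_weight i (x, y) * cmod (1 - t%:C * (x +i* y)) ^+ 2.
  rewrite ler_pM ?sqr_ge0 ?mulr_ge0 ?powR_ge0 ?exprn_ge0//.
    exact: layer_weight_ge.
  by rewrite lerXn2r ?nnegrE ?cmod_ge0// divr_ge0// ltW.
rewrite (le_trans _ (ler_wpM2l _ A))// le_eqVlt.
apply/orP; left; apply/eqP.
have -> : (4 : R) ^+ j = 2 ^+ j * 2 ^+ j by rewrite -exprMn -natrM.
by rewrite exprVn; field; rewrite expf_neq0.
Qed.

End DiscKernel.

Lemma cvg_sum_nat (K : numFieldType) (V : normedModType K)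
    (u : nat -> nat -> V) (l : nat -> V) (m : nat) :
  (forall i, u i @ \oo --> l i) ->
  (fun k => \sum_(0 <= i < m) u i k) @ \oo --> \sum_(0 <= i < m) l i.
Proof.
move=> ul; elim: m => [|m IHm].
  rewrite big_nil (_ : (fun k => _) = fun=> 0); first exact: cvg_cst.
  by apply/funext => k; rewrite big_nil.
rewrite big_nat_recr//= (_ : (fun k => _) =
    fun k => \sum_(0 <= i < m) u i k + u m k); first exact: cvgD.
by apply/funext => k; rewrite big_nat_recr.
Qed.

(** * Moments and integrals of complex polynomials *)

Section Moments.
Variable R : realType.
Variable mu : {finite_measure set (measurableTypeR R) -> \bar R}.
Local Notation D := (`[0, 1[%classic : set (measurableTypeR R)).

Lemma Re_mulr_real (z : R[i]) (t : R) :
  complex.Re (z * t%:C) = complex.Re z * t.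
Proof. by case: z => a b /=; rewrite mulr0 subr0. Qed.

Lemma Im_mulr_real (z : R[i]) (t : R) :
  complex.Im (z * t%:C) = complex.Im z * t.
Proof. by case: z => a b /=; rewrite mulr0 add0r. Qed.

Lemma Re_sum (I : Type) (r : seq I) (F : I -> R[i]) :
  complex.Re (\sum_(x <- r) F x) = \sum_(x <- r) complex.Re (F x).
Proof. exact: raddf_sum. Qed.

Lemma Im_sum (I : Type) (r : seq I) (F : I -> R[i]) :
  complex.Im (\sum_(x <- r) F x) = \sum_(x <- r) complex.Im (F x).
Proof. exact: raddf_sum. Qed.

Lemma real_complexX (t : R) n : (t ^+ n)%:C = t%:C ^+ n.
Proof. exact: rmorphXn. Qed.

Lemma integrable_pow n : mu.-integrable D (EFin \o (fun t => t ^+ n)).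
Proof.
apply: measurable_bounded_integrable.
- exact: measurable_itv.
- by rewrite ltey_eq fin_num_measure//; exact: measurable_itv.
- by apply: measurable_funX; exact: measurable_id.
- exists 1; split => // x x1 t /=; rewrite in_itv/= => /andP[t0 t1].
  by rewrite normrX (le_trans _ (ltW x1))// exprn_ile1// ger0_norm// ltW.
Qed.

Lemma Rintegral_sum_pow (I : Type) (r : seq I) (b : I -> R) (e : I -> nat) :
  mu.-integrable D (EFin \o (fun t => \sum_(x <- r) b x * t ^+ e x)) /\
  \int[mu]_(t in D) (\sum_(x <- r) b x * t ^+ e x) =
    \sum_(x <- r) b x * moment mu (e x).
Proof.
have mD : measurable D by exact: measurable_itv.
elim: r => [|y r [IH1 IH2]].
  split; last first.
    under eq_Rintegral do rewrite big_nil.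
    by rewrite big_nil Rintegral_cst// mul0r.
  apply: (eq_integrable mD (cst 0%E)) => [t _|]; first by rewrite /= big_nil.
  exact: integrable0.
pose g (t : measurableTypeR R) := b y * t ^+ e y.
pose G (t : measurableTypeR R) := \sum_(x <- r) b x * t ^+ e x.
have i1 : mu.-integrable D (EFin \o g).
  have -> : EFin \o g = (fun t => (b y)%:E * (t ^+ e y)%R%:E)%E.
    by apply/funext => t; rewrite /= EFinM.
  by apply: integrableZl => //; exact: integrable_pow.
split.
  have -> : EFin \o (fun t => \sum_(x <- y :: r) b x * t ^+ e x) =
    ((EFin \o g) \+ (EFin \o G))%E.
    by apply/funext => t; rewrite /= big_cons EFinD.
  exact: integrableD.
under eq_Rintegral do rewrite big_cons.
rewrite RintegralD// big_cons IH2 RintegralZl//.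
exact: integrable_pow.
Qed.

(** The inequality of the modulus of an integral and the integral of the modulus, with only real
    integrals at hand: a unimodular u turns the sum into a real number, and Re (u P) <= |P| under
    the integral. *)
Lemma cmod_sum_moments_le (I : Type) (r : seq I) (b : I -> R[i])
    (e : I -> nat) :
  ((cmod (\sum_(x <- r) b x * (moment mu (e x))%:C))%:E <=
   \int[mu]_(t in D) (cmod (\sum_(x <- r) b x * t%:C ^+ e x))%:E)%E.
Proof.
set S := \sum_(x <- r) _.
have [u u1 uS] : exists2 u : R[i], cmod u = 1 & cmod S = complex.Re (u * S).
  have [->|S0] := eqVneq S 0.
    by exists 1; rewrite ?cmod1// mulr0 cmod0.
  have cS : cmod S != 0 by rewrite cmod_eq0.
  exists ((cmod S)%:C * S^-1); last by rewrite mulfVK.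
  by rewrite cmodM cmodV cmod_real ger0_norm ?cmod_ge0// divff.
have [int_f int_fE] := Rintegral_sum_pow r (fun x => complex.Re (u * b x)) e.
have -> : cmod S = \sum_(x <- r) complex.Re (u * b x) * moment mu (e x).
  rewrite uS mulr_sumr Re_sum; apply: eq_bigr => x _.
  by rewrite mulrA Re_mulr_real.
rewrite -int_fE /Rintegral fineK; last exact: (integrable_fin_num _ int_f).
pose f (t : measurableTypeR R) := (\sum_(x <- r) complex.Re (u * b x) * t ^+ e x)%:E.
rewrite -[X in (integral _ _ X <= _)%E]/f integralE.
rewrite (@le_trans _ _ (\int[mu]_(x in D) (f^\+ x))%E)//.
  have [fp fn] : (\int[mu]_(x in D) (f^\+ x) \is a fin_num)%E /\
      (\int[mu]_(x in D) (f^\- x) \is a fin_num)%E.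
    by split; apply: integrable_fin_num => //;
      [exact: integrable_funepos|exact: integrable_funeneg].
  by rewrite leeBlDr// leeDl// integral_ge0.
apply: ge0_le_integralW => t _; first by [].
rewrite funeposE ge_max; apply/andP; split; rewrite lee_fin ?cmod_ge0//.
rewrite -[leRHS]mul1r -u1 -cmodM (le_trans _ (Re_le_cmod _))//.
rewrite mulr_sumr Re_sum le_eqVlt; apply/orP; left; apply/eqP.
by apply: eq_bigr => x _; rewrite -real_complexX mulrA Re_mulr_real.
Qed.

Lemma measurable_cmod_sum_pow (I : Type) (r : seq I) (b : I -> R[i])
    (e : I -> nat) :
  measurable_fun D (fun t => cmod (\sum_(x <- r) b x * t%:C ^+ e x)).
Proof.
have mP (g : I -> R) : measurable_fun D (fun t => \sum_(x <- r) g x * t ^+ e x).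
  apply: measurable_sum => x; apply: measurable_funM; first exact: measurable_cst.
  by apply: measurable_funX; exact: measurable_id.
rewrite (_ : (fun t => _) = Num.sqrt \o (fun t =>
    (\sum_(x <- r) complex.Re (b x) * t ^+ e x) ^+ 2 +
    (\sum_(x <- r) complex.Im (b x) * t ^+ e x) ^+ 2)).
  apply: (measurableT_comp (continuous_measurable_fun (@sqrt_continuous R))).
  by apply: measurable_funD; apply: measurable_funX; exact: mP.
apply/funext => t; rewrite cmod_Re_Im /= Re_sum Im_sum.
by congr (Num.sqrt (_ ^+ 2 + _ ^+ 2)); apply: eq_bigr => x _;
  rewrite -real_complexX ?Re_mulr_real ?Im_mulr_real.
Qed.

End Moments.

(** * The Hankel operator *)

Section HankelDerivative.
Variables (R : realType) (alpha : R).
Variable mu : {finite_measure set (measurableTypeR R) -> \bar R}.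
Local Notation h i := ((2^-1 : R) ^+ i).
Local Notation weight z := (ln (2 / (1 - cmod z)) `^ (alpha - 1)).

Lemma sum_expr_deriv (u : R[i]) N :
  (1 - u) ^+ 2 * \sum_(0 <= n < N) n.+1%:R * u ^+ n =
  1 - N.+1%:R * u ^+ N + N%:R * u ^+ N.+1.
Proof.
elim: N => [|N IHN]; first by rewrite big_nil expr0; ring.
by rewrite big_nat_recr//= mulrDr IHN !exprS; ring.
Qed.

(** For r < 1 the bound tends to 1, so partial sums of (1 - u)^(-2) are nearly as small as the full
    sum. *)
Lemma cmod_sum_expr_deriv_le (u : R[i]) (r : R) N : cmod u <= r -> r <= 1 ->
  cmod (1 - u) ^+ 2 * cmod (\sum_(0 <= n < N) n.+1%:R * u ^+ n) <=
  1 + (2 * N%:R + 1) * r ^+ N.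
Proof.
move=> ur r1; have r0 : 0 <= r by rewrite (le_trans _ ur)// cmod_ge0.
rewrite -cmodX -cmodM sum_expr_deriv (le_trans (cmod_le_add _ _))//.
rewrite (le_trans (lerD (cmod_le_sub _ _) (lexx _)))// cmod1 -addrA lerD2l.
rewrite !cmodM !cmodX !cmod_natr.
have uN n : cmod u ^+ n <= r ^+ n by rewrite lerXn2r ?nnegrE ?cmod_ge0.
have H1 : N.+1%:R * cmod u ^+ N <= N.+1%:R * r ^+ N by rewrite ler_wpM2l.
have H2 : N%:R * cmod u ^+ N.+1 <= N%:R * r ^+ N.
  rewrite ler_wpM2l// (le_trans (uN _))// exprS -[leRHS]mul1r.
  by rewrite ler_wpM2r ?exprn_ge0.
rewrite (le_trans (lerD H1 H2))// -natr1 le_eqVlt; apply/orP; left; apply/eqP.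
by ring.
Qed.

(** [F i] majorizes sum_k |a_k| t^k for t in layer i, and [kernel_le] has the form supplied by
    [disc_kernel_le]. *)
Variables (a : nat -> R[i]^o) (F : nat -> R) (C : R).
Hypothesis aF : forall i K,
  \sum_(0 <= k < K) cmod (a k) * (1 - h i.+1) ^+ k <= F i.
Hypothesis C_gt0 : 0 < C.
Hypothesis kernel_le : forall (i : nat) (x y t : R), cmod (x +i* y) < 1 ->
  1 - h i <= t -> t < 1 - h i.+1 ->
  weight (x +i* y) <=
  C * layer_weight alpha i (x, y) * cmod (1 - t%:C * (x +i* y)) ^+ 2.

Lemma majorant_ge0 i : 0 <= F i.
Proof. by rewrite (le_trans _ (aF i 0))// big_nil. Qed.

(* The double sum is the integral against mu of P_N(t z) t A_K(t), with P_N a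
   partial sum of (1 - u)^(-2) and A_K one of f. *)
Lemma hankel_derivative_partial_le (N K : nat) (x y : R) :
  cmod (x +i* y) < 1 ->
  ((weight (x +i* y) * cmod (\sum_(0 <= n < N) n.+1%:R * (x +i* y) ^+ n *
     \sum_(0 <= k < K) hankel_row mu a n.+1 k))%:E <=
  (1 + (2 * N%:R + 1) * cmod (x +i* y) ^+ N)%:E *
  \sum_(i <oo) (C * layer_weight alpha i (x, y) * F i * layer_mass mu i)%:E)%E.
Proof.
move=> z1; set z := x +i* y in z1 *; set w := weight z.
have w0 : 0 <= w by rewrite powR_ge0.
set E := 1 + _.
have E0 : 0 <= E by rewrite addr_ge0// mulr_ge0 ?exprn_ge0 ?cmod_ge0// addr_ge0// mulr_ge0.
have g0 i : 0 <= C * layer_weight alpha i (x, y) * F i * layer_mass mu i.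
  by rewrite !mulr_ge0 ?layer_weight_ge0 ?majorant_ge0 ?layer_mass_ge0// ltW.
(* The double sum is flattened over pairs (n, k) with the weight absorbed, so as to be a single
   combination of moments; the exponent n+1+k reflects the use of row n+1. *)
pose b (p : 'I_N * 'I_K) : R[i] := w%:C * (p.1.+1%:R * z ^+ p.1) * a p.2.
pose e (p : 'I_N * 'I_K) : nat := (p.1.+1 + p.2)%N.
have -> : w * cmod (\sum_(0 <= n < N) n.+1%:R * z ^+ n *
     \sum_(0 <= k < K) hankel_row mu a n.+1 k) =
   cmod (\sum_p b p * (moment mu (e p))%:C).
  rewrite -{1}(ger0_norm w0) -cmod_real -cmodM; congr cmod.
  rewrite mulr_sumr big_mkord.
  rewrite -(pair_bigA _ (fun n k => b (n, k) * (moment mu (e (n, k)))%:C))/=.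
  apply: eq_bigr => n _; rewrite mulrA mulr_sumr big_mkord.
  apply: eq_bigr => k _; rewrite /hankel_row /b /e/=; ring.
apply: (le_trans (cmod_sum_moments_le mu (index_enum _) b e)).
rewrite -nneseriesZl; last by move=> i _; rewrite lee_fin.
under eq_eseriesr do rewrite -EFinM mulrA.
apply: (@dyadic_integral_le _ mu (fun t => cmod (\sum_p b p * t%:C ^+ e p))
   (fun i => E * (C * layer_weight alpha i (x, y) * F i))).
- exact: measurable_cmod_sum_pow.
- by move=> t _; exact: cmod_ge0.
move=> i t; rewrite /dyadic_layer/= in_itv/= => /andP[t0 t1].
have t0' : 0 <= t by rewrite (le_trans _ t0)// subr_ge0 half_exp_le1.
have t1' : t <= 1 by rewrite (le_trans (ltW t1))// gerBl half_exp_ge0.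
pose P := \sum_(0 <= n < N) n.+1%:R * (t%:C * z) ^+ n.
pose A := \sum_(0 <= k < K) a k * t%:C ^+ k.
have -> : \sum_p b p * t%:C ^+ e p = w%:C * P * t%:C * A.
  rewrite -(pair_bigA _ (fun n k => b (n, k) * t%:C ^+ e (n, k)))/=.
  rewrite /P big_mkord [w%:C * _]mulr_sumr !mulr_suml; apply: eq_bigr => n _.
  rewrite /A big_mkord mulr_sumr; apply: eq_bigr => k _.
  by rewrite /b /e/= exprMn exprD exprS; ring.
have tz : cmod (t%:C * z) <= cmod z.
  rewrite cmodM cmod_real ger0_norm// -[leRHS]mul1r.
  by rewrite ler_wpM2r ?cmod_ge0.
have HP := cmod_sum_expr_deriv_le N tz (ltW z1).
have HA : cmod A <= F i.
  apply: (le_trans _ (aF i K)); rewrite (le_trans (cmod_sum _ _ _))//.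
  apply: ler_sum => k _; rewrite cmodM cmodX cmod_real ger0_norm//.
  by rewrite ler_wpM2l ?cmod_ge0// lerXn2r ?nnegrE ?(le_trans t0')// ltW.
rewrite !cmodM !cmod_real !ger0_norm//.
have HwP : w * cmod P <= C * layer_weight alpha i (x, y) * E.
  rewrite (le_trans (ler_wpM2r (cmod_ge0 P) (kernel_le z1 t0 t1)))//.
  rewrite -[leLHS]mulrA ler_wpM2l// mulr_ge0 ?layer_weight_ge0//.
  exact: ltW.
rewrite [leRHS]mulrA [E * _]mulrC ler_pM ?mulr_ge0 ?cmod_ge0//.
by rewrite -[leRHS]mulr1 ler_pM ?mulr_ge0 ?cmod_ge0.
Qed.

(** First K tends to infinity with N fixed, then N; the factor 1 + (2 N + 1) |z|^N is eventually at
    most 2. *)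
Lemma hankel_derivative_le (c : nat -> R[i]^o) (x y : R) (d : R[i]^o) :
  (forall n, series (hankel_row mu a n) @ \oo --> c n) ->
  cmod (x +i* y) < 1 ->
  series (fun n => n.+1%:R * c n.+1 * (x +i* y : R[i]^o) ^+ n : R[i]^o) @ \oo --> d ->
  ((cmod d * weight (x +i* y))%:E <=
  2%:E * \sum_(i <oo)
    (C * layer_weight alpha i (x, y) * F i * layer_mass mu i)%:E)%E.
Proof.
move=> rowc z1 Sd; set z := x +i* y in z1 Sd *.
have w0 : 0 < weight z.
  rewrite powR_gt0// ln_gt0// ltr_pdivlMr ?subr_gt0// mul1r.
  by have := cmod_ge0 z; lra.
set T := (\sum_(i <oo) _)%E.
have T0 : (0 <= T)%E.
  apply: nneseries_ge0 => i _ _; rewrite lee_fin.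
  by rewrite !mulr_ge0 ?layer_weight_ge0 ?majorant_ge0 ?layer_mass_ge0// ltW.
have partial N K := hankel_derivative_partial_le N K z1.
(* If the series on the right is infinite there is nothing to prove. *)
move: partial T0; rewrite -/z -/T; case: T => [T|_ _|//]; last first.
  by rewrite mulry gtr0_sg ?mul1e ?leey// ltr0n.
move=> partial; rewrite lee_fin => T0.
have partialN N : cmod (series (fun n => n.+1%:R * c n.+1 * z ^+ n : R[i]^o) N - 0) <=
    (1 + (2 * N%:R + 1) * cmod z ^+ N) * T / weight z.
  pose u n K : R[i]^o := n.+1%:R * z ^+ n * series (hankel_row mu a n.+1) K.
  have uc : (fun K => \sum_(0 <= n < N) u n K) @ \oo -->
      series (fun n => n.+1%:R * c n.+1 * z ^+ n : R[i]^o) N.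
    apply: cvg_sum_nat => n; rewrite mulrAC.
    by apply: cvgM; [exact: cvg_cst|exact: rowc].
  apply: (cvg_cmod_le (N := 0) uc) => K _.
  rewrite subr0 ler_pdivlMr// mulrC -lee_fin EFinM.
  exact: partial.
have [B B0 HB] := natX_geometric_bounded 2 (cmod_ge0 z) z1.
(* For N >= N0 one has N (2 N + 1) |z|^N <= 3 N^2 |z|^N <= 3 B <= N, hence (2 N + 1) |z|^N <= 1. *)
pose N0 := (Num.truncn (3 * B)).+1.
rewrite lee_fin -ler_pdivlMr//.
rewrite -[d]subr0; apply: (cvg_cmod_le (N := N0) Sd) => N NN0.
rewrite (le_trans (partialN N))// ler_pM2r ?invr_gt0// ler_wpM2r//.
have N1 : 1 <= N%:R :> R by rewrite ler1n (leq_trans _ NN0).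
have q0 : 0 <= cmod z ^+ N by rewrite exprn_ge0// cmod_ge0.
have : (2 * N%:R + 1) * cmod z ^+ N <= 1; last lra.
have N3 : 3 * B <= N%:R by rewrite (le_trans (ltW (truncnS_gt _)))// ler_nat.
rewrite -(ler_pM2l (lt_le_trans ltr01 N1)) mulr1 (le_trans _ N3)//.
rewrite (@le_trans _ _ (3 * (N%:R ^+ 2 * cmod z ^+ N)))//; last by rewrite ler_pM2l.
by rewrite !mulrA ler_wpM2r//; nra.
Qed.

End HankelDerivative.

(** * Summation over the layers and the conclusion *)

Section HankelOnHardy.
Variables (R : realType) (alpha : R).
Variable mu : {finite_measure set (measurableTypeR R) -> \bar R}.
Hypotheses (alpha_gt0 : 0 < alpha) (alpha_lt1 : alpha < 1).
Hypothesis mu_carleson : log_carleson alpha 1 mu.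
Local Notation h i := ((2^-1 : R) ^+ i).
Local Notation leb2 := (@lebesgue_measure R \x @lebesgue_measure R)%E.

(** Exchanging the sums and applying [sum_dyadic_pow] bounds every truncation by 4 B. This also
    bounds each inner sum for fixed i, so [F i] can be its limit. *)
Lemma dyadic_majorants (x : nat -> R) (B : R) : (forall k, 0 <= x k) ->
  (forall n, \sum_(0 <= k < n) x k / k.+1%:R <= B) ->
  exists2 F : nat -> R,
    (forall i K, \sum_(0 <= k < K) x k * (1 - h i.+1) ^+ k <= F i) &
    forall m, \sum_(0 <= i < m) h i * F i <= 4 * B.
Proof.
move=> x0 xB; pose A i K := \sum_(0 <= k < K) x k * (1 - h i.+1) ^+ k.
have t0 i k : 0 <= x k * (1 - h i.+1) ^+ k.
  by rewrite mulr_ge0 ?exprn_ge0// subr_ge0 half_exp_le1.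
have sumA m K : \sum_(0 <= i < m) h i * A i K <= 4 * B.
  rewrite (@le_trans _ _ (4 * \sum_(0 <= k < K) x k / k.+1%:R))//; last first.
    by rewrite ler_pM2l.
  under eq_bigr do rewrite mulr_sumr.
  rewrite exchange_big mulr_sumr; apply: ler_sum => k _ /=.
  under eq_bigr do rewrite mulrCA.
  by rewrite -mulr_sumr mulrCA ler_wpM2l// sum_dyadic_pow.
have A_cvg i : cvgn (A i).
  apply: nondecreasing_is_cvgn.
    apply/nondecreasing_seqP => K; rewrite /A big_nat_recr//= lerDl//.
  exists (4 * B / h i) => _ [K _ <-].
  rewrite ler_pdivlMr ?half_exp_gt0// mulrC (le_trans _ (sumA i.+1 K))//.
  rewrite big_nat_recr//= lerDr sumr_ge0// => j _.
  by rewrite mulr_ge0 ?half_exp_ge0// sumr_ge0.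
exists (fun i => limn (A i)) => [i K|m].
  apply: (nondecreasing_cvgn_le _ (A_cvg i)).
  by apply/nondecreasing_seqP => k; rewrite /A big_nat_recr//= lerDl.
have lm : (fun K => \sum_(0 <= i < m) h i * A i K) @ \oo -->
    \sum_(0 <= i < m) h i * limn (A i).
  apply: (@cvg_sum_nat R R^o (fun i K => h i * A i K)) => i.
  by apply: cvgM; [exact: cvg_cst|exact: A_cvg].
rewrite -(cvg_lim _ lm)//; apply: limr_le; first by apply/cvg_ex; eexists; exact: lm.
by apply: nearW => K; exact: sumA.
Qed.

Lemma area_integral_le (G : R[i] -> R) (k : nat -> R) (Q : R) :
  (forall z, cmod z < 1 -> 0 <= G z) -> (forall i, 0 <= k i) ->
  (forall x y, cmod (x +i* y) < 1 ->
    ((G (x +i* y))%:E <= \sum_(i <oo) (k i * layer_weight alpha i (x, y))%:E)%E) ->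
  (forall m, \sum_(0 <= i < m) k i * i.+1%:R `^ alpha <= Q) ->
  (area_integral G < +oo)%E.
Proof.
move=> G0 k0 Gk kQ.
have kw0 i p : 0 <= k i * layer_weight alpha i p.
  by rewrite mulr_ge0// layer_weight_ge0.
have mkw i : measurable_fun setT (fun p => (k i * layer_weight alpha i p)%:E).
  apply/measurable_EFinP; apply: measurable_funM; first exact: measurable_cst.
  exact: measurable_layer_weight.
have H : (\int[leb2]_(p in [set p | unit_disc (p.1 +i* p.2)])
    (G (p.1 +i* p.2))%:E <= (32 / alpha * Q)%:E)%E.
  rewrite integral_mkcond.
  apply: (@le_trans _ _ (\int[leb2]_p
      (\sum_(i <oo) (k i * layer_weight alpha i p)%:E))%E).
    apply: ge0_le_integralW => -[x y] _; rewrite /patch.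
      by case: ifPn => // /set_mem; rewrite /= unit_discE => z1; rewrite lee_fin G0.
    case: ifPn => [/set_mem|_]; first exact: Gk.
    by apply: nneseries_ge0 => i _ _; rewrite lee_fin.
  rewrite integral_nneseries//; last by move=> i p _; rewrite lee_fin.
  (* Each square contributes 16 (j+1)^(alpha-1), its area cancelling 4^j; [sum_powR_le] then sums
     these to at most (32 / alpha) (i+1)^alpha. *)
  have intE i : (\int[leb2]_p (k i * layer_weight alpha i p)%:E =
      (k i * (16 * \sum_(0 <= j < i.+1) j.+1%:R `^ (alpha - 1)))%:E)%E.
    under eq_integral do rewrite EFinM.
    rewrite ge0_integralZl//.
    - by rewrite integral_layer_weight -EFinM.
    - apply/measurable_EFinP; exact: measurable_layer_weight.
    - by move=> p _; rewrite lee_fin layer_weight_ge0.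
    - by rewrite lee_fin.
  under eq_eseriesr do rewrite intE.
  apply: nneseries_le => [i|m].
    by rewrite !mulr_ge0// sumr_ge0// => j _; rewrite powR_ge0.
  rewrite (@le_trans _ _ (32 / alpha * \sum_(0 <= i < m) k i * i.+1%:R `^ alpha))//.
    rewrite mulr_sumr; apply: ler_sum => i _; rewrite [leRHS]mulrCA ler_wpM2l//.
    have Hi := sum_powR_le i.+1 alpha_gt0 alpha_lt1.
    rewrite (le_trans (ler_wpM2l _ Hi))// le_eqVlt.
    by apply/orP; left; apply/eqP; field; rewrite gt_eqF.
  by rewrite ler_wpM2l// divr_ge0// ltW.
rewrite /area_integral; apply: (@le_lt_trans _ _ (pi^-1%:E * (32 / alpha * Q)%:E)%E).
  by rewrite lee_wpmul2l// lee_fin invr_ge0 ltW// pi_gt0.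
by rewrite -EFinM ltry.
Qed.

Lemma hankel_maps_hardy1 : hankel_maps mu (@hardy1 R) (dirichlet1_log (alpha - 1)).
Proof.
move=> f a f1 fa; have [B HB] := hardy_inequality f1 fa.
have [C1 C10 HC1] := carleson_layer_mass alpha_gt0 mu_carleson.
have massC i : layer_mass mu i <= C1 * h i.
  rewrite (le_trans _ (HC1 i))// -[leLHS]mulr1 ler_wpM2l ?layer_mass_ge0//.
  have p1 : 1 `^ alpha = 1 :> R by rewrite powR1.
  rewrite -[leLHS]p1 ge0_ler_powR ?nnegrE ?(ltW alpha_gt0)//.
  by rewrite ler1n.
have momC := moment_le C10 massC.
pose M := 4 * C1 * B.
(* The moment of order n + k is at most 4 C1 / (k+1) whatever n is, so Hardy's inequality gives
   absolute convergence of all rows with one common bound. The coefficients of the image are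
   therefore bounded, which yields its analyticity. *)
have rowM n K : \sum_(0 <= k < K) cmod (hankel_row mu a n k) <= M.
  rewrite (@le_trans _ _ (4 * C1 * \sum_(0 <= k < K) cmod (a k) / k.+1%:R))//.
    rewrite mulr_sumr; apply: ler_sum => k _; rewrite /hankel_row cmodM cmod_real.
    rewrite ger0_norm ?moment_ge0// mulrA mulrAC ler_wpM2r ?cmod_ge0//.
    rewrite (le_trans (momC _))// ler_wpM2l ?mulr_ge0 ?(ltW C10)//.
    by rewrite lef_pV2 ?posrE// ler_nat ltnS leq_addl.
  by rewrite /M ler_wpM2l// mulr_ge0// ltW.
have rowc n : series (hankel_row mu a n) @ \oo --> hankel_coef mu a n.
  have [l hl] := abs_summable_cvg (rowM n).
  by rewrite /hankel_coef (limn_cmod hl); exact: hl.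
have coefM n : cmod (hankel_coef mu a n) <= M.
  rewrite -[hankel_coef mu a n]subr0; apply: (cvg_cmod_le (N := 0) (rowc n)) => K _.
  by rewrite subr0 (le_trans (cmod_sum _ _ _)).
have M0 : 0 <= M by rewrite (le_trans _ (coefM 0%N))// cmod_ge0.
have Hps : has_power_series (hankel mu a) (hankel_coef mu a).
  move=> z; rewrite unit_discE => z1.
  have z0 := cmod_ge0 z; pose r := (1 + cmod z) / 2.
  have r0 : 0 < r by rewrite /r; lra.
  have r1 : r < 1 by rewrite /r; lra.
  have zr : cmod z <= r by rewrite /r; lra.
  have [K0 K00 HK0] := sum_natX_geometric_bounded 0 r0 r1.
  have [|l hl] := @abs_summable_cvg R (fun n => hankel_coef mu a n * z ^+ n) (M * K0).
    move=> n; rewrite (le_trans _ (ler_wpM2l M0 (HK0 n)))// mulr_sumr.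
    apply: ler_sum => k _; rewrite cmodM cmodX expr0 mul1r.
    by rewrite ler_pM ?exprn_ge0 ?cmod_ge0// lerXn2r ?nnegrE ?(ltW r0).
  by rewrite /hankel (limn_cmod hl); exact: hl.
have Han : analytic_in_disc (hankel mu a).
  by move=> z zd; have [d []] := power_series_derivative Hps coefM zd.
split; first by split => // n; apply/cvg_ex; exists (hankel_coef mu a n); exact: rowc.
split=> //.
have [F aF hF] := dyadic_majorants (fun k => cmod_ge0 (a k)) HB.
have [C C0 HC] := disc_kernel_le alpha_lt1.
have F0 := majorant_ge0 aF.
apply: (@area_integral_le _ (fun i => 2 * (C * F i * layer_mass mu i))
  (2 * (C * (C1 * (4 * B))))).
- by move=> z z1; rewrite mulr_ge0 ?cmod_ge0 ?powR_ge0.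
- by move=> i; rewrite !mulr_ge0 ?layer_mass_ge0 ?F0 ?(ltW C0).
- move=> x y z1.
  have [d [Sd _ ->]] := power_series_derivative Hps coefM (z1 : unit_disc (x +i* y : R[i]^o)).
  rewrite (le_trans (hankel_derivative_le aF C0 HC rowc z1 Sd))//.
  rewrite -nneseriesZl; last first.
    by move=> i _; rewrite lee_fin !mulr_ge0 ?layer_weight_ge0 ?F0 ?layer_mass_ge0// ltW.
  rewrite le_eqVlt; apply/orP; left; apply/eqP; apply: eq_eseriesr => i _.
  by rewrite -EFinM; congr EFin; ring.
(* The Carleson bound replaces the mass times (i+1)^alpha by C1 2^-i, and the remaining sum is
   controlled by the choice of F. *)
- move=> m; rewrite (@le_trans _ _ (2 * (C * (C1 * \sum_(0 <= i < m) h i * F i))))//.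
    rewrite !mulr_sumr; apply: ler_sum => i _.
    rewrite -!mulrA ler_pM2l// ler_pM2l//.
    rewrite [leRHS](_ : _ = F i * (C1 * h i)); last by ring.
    by rewrite ler_wpM2l ?F0.
  by rewrite ler_pM2l// ler_pM2l// ler_pM2l.
Qed.

End HankelOnHardy.

Theorem theorem2 (R : realType)
    (mu : {finite_measure set (measurableTypeR R) -> \bar R}) (alpha : R)
    (mu_01 : carried_by_01 mu)
    (alpha_gt0 : 0 < alpha) (alpha_lt1 : alpha < 1)
    (mu_carleson : log_carleson alpha 1 mu) :
  hankel_maps mu (@hardy1 R) (dirichlet1_log (alpha - 1)).
Proof. exact: hankel_maps_hardy1. Qed.
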